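(* Let $M$ be compact, and let $\{(T_i,M,\mu_i)\}_{i=1}^q$ be systems where each $T_i:M\to M$ preserves a probability measure $\mu_i$ having a density in $L^p$ for some $p>1$, and each $\mu_i$ is mixing with respect to $T_i$. Let each $\phi_i:M\to[0,1)$ be positive and H\''older continuous with $\int\log\phi_i\,d\mu_i<0$. Take $n_k=q$ for all $k$. For $\mathbf{x}=(x_1,\dots,x_q)\in M^q$ let $F=F(\mathbf{x})\subset\mathbb{R}^d$ be a generalized Moran set (GMS) arising from a Moran structure with vector $\overline\Psi$ generated by $$c^{(k)}_i=\phi_i(T_i^k(x_i)),\quad 1\le i\le q,\ k\ge1,\qquad\text{i.e. }\ \Psi^{(k)}_\omega=\prod_{j=1}^k\phi_{i_j}(T_{i_j}^j(x_{i_j})),\quad\omega=(i_1,\dots,i_k),$$ and suppose that this vector is basic, satisfies (UE) and (LE), and that (A3) holds. Let $\boldsymbol\mu=\mu_1\times\cdots\times\mu_q$. Then for $\boldsymbol\mu$-a.e. $\mathbf{x}\in M^q$, $$\dim_H(F)=\dim_P(F)=\overline{\dim}_B(F)=s_*,$$ where $s_*$ is the unique solution of $$\int_{M^q}\log\Big\{\sum_{i=1}^q\phi_i(x_i)^{s_*}\Big\}\,d\boldsymbol\mu(\mathbf{x})=0.$$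
   Context: $M$ is a compact metric space carrying a reference (Lebesgue) measure, with respect to which densities and $L^p$ are understood. **Words.** $d\ge1$, $n_k=q$ for all $k$. Let $D_k=\{1,\dots,q\}^k$, $D_0=\{\emptyset\}$, $D=\bigcup_{k\ge0}D_k$, $D^*=\{1,\dots,q\}^{\mathbb{N}}$. For $\omega\in D_{k-1}$ and $1\le j\le q$, $\omega*j\in D_k$ is the concatenation. **Class $\Im$.** A map $f:\mathbb{R}^d\to\mathbb{R}^d$ is in $\Im$ if there is a compact set $A$ with $f(A)\subset A$ such that $\mathrm{diam}(f^n(B))\to0$ as $n\to\infty$ for every compact $B\subset A$. **Moran structure and GMS.** Let $\triangle\subset\mathbb{R}^d$ be compact and $f_{k,j}\in\Im$ ($k\ge1$, $1\le j\le q$). For $\omega=(i_1,\dots,i_k)\in D_k$ put $f_\omega=f_{1,i_1}\circ\cdots\circ f_{k,i_k}$ and $\triangle_\omega=f_\omega(\triangle)$, $\triangle_\emptyset=\triangle$. It is assumed that all $\triangle_\omega$ are compact, $\triangle_{\omega*j}\subseteq\triangle_\omega$ whenever $\omega\in D_{k-1}$, $\omega*j\in D_k$, and $\lim_{k\to\infty}\max_{\omega\in D_k}\mathrm{diam}(\triangle_\omega)=0$. Put $F=\bigcap_{k}\bigcup_{\omega\in D_k}\triangle_\omega$. $F$ is a generalized Moran set (GMS) if moreover $\triangle_\omega\cap\triangle_{\omega'}\cap F=\emptyset$ for all $k$ and all distinct $\omega,\omega'\in D_k$. Then each $y\in F$ equals $\bigcap_k\triangle_{(i_1,\dots,i_k)}$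 for a unique $(i_j)_{j\ge1}\in D^*$, its coding. **Vectors.** Given constants $c^{(k)}_j$, $\Psi^{(k)}_\omega=\Psi^{(k)}(\omega)=\prod_{j=1}^k c^{(j)}_{i_j}$ for $\omega=(i_1,\dots,i_k)\in D_k$. The collection $\overline\Psi=\{(\Psi^{(k)}_\omega)_{\omega\in D_k}\}_{k\ge1}$ is *basic* if $\sup_{k,j}c^{(k)}_j<1$. A basic collection is (UE) if there is $C>0$ with $\mathrm{diam}(\triangle_\omega)\le C\Psi^{(k)}_\omega$ for all $k$, $\omega\in D_k$. *(LE).* For $0<r<1$ and $y\in F$ with coding $(i_j)$, let $n(y)$ be the unique integer with $\Psi^{(n(y))}_{(i_1,\dots,i_{n(y)})}>r$ and $\Psi^{(n(y)+1)}_{(i_1,\dots,i_{n(y)+1})}\le r$ (convention $\Psi^{(0)}=1$), and let $\triangle(y)$ be the set of points of $F$ whose codings begin with $(i_1,\dots,i_{n(y)})$. The distinct sets among the $\triangle(y)$ form the Moran covering $\{\triangle^{(j)}\}$ of $F$ at scale $r$. Let $N(y,r)$ be the number of $\triangle^{(j)}$ meeting the open ball $B(y,r)$. A basic collection is (LE) if there is a constant $M_0$ with $N(y,r)<M_0$ for all $y\in F$, $0<r<1$. **(A3).** For every $\beta>0$ there are a Borel probability measure $m_\Psi$ (depending on $\beta$) supported on $F$ and $L>0$ such that for all $k\ge1$, $\omega\in D_k$: $$\frac{L^{-1}}{\sum_{\omega'\in D_k}(\Psi^{(k)}(\omega'))^{\beta}}\le\frac{m_\Psi(\triangle_\omega)}{(\Psi^{(k)}(\omega))^\beta}\le\frac{L}{\sum_{\omega'\in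 D_k}(\Psi^{(k)}(\omega'))^{\beta}}.$$ $\dim_H,\dim_P,\overline{\dim}_B$ are Hausdorff, packing and upper box dimension. *)

(* Defs.v *)
(* MathComp-Analysis *)
From HB Require Import structures.
From mathcomp Require Import all_boot all_order all_algebra.
From mathcomp Require Import all_classical all_reals all_analysis.

Set Implicit Arguments.
Unset Strict Implicit.
Unset Printing Implicit Defensive.

Import Order.TTheory GRing.Theory Num.Theory.
Import numFieldNormedType.Exports.

Local Open Scope classical_set_scope.
Local Open Scope ring_scope.

(* A base point is needed only because [g_sigma_algebraType] expects a pointed
   type. *)
#[short(type="pmetricType")]
HB.structure Definition PointedMetric (K : numDomainType) :=
  {M of Pointed M & Metric K M}.

Notation borelType M := (g_sigma_algebraType (@open M)).

Section product_probability.
Context {d : measure_display} {T : measurableType d} {R : realType}.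
Local Open Scope ereal_scope.

Definition cons_pair (n : nat) (z : T * n.-tuple T) : n.+1.-tuple T :=
  [tuple of z.1 :: z.2].

Lemma measurable_cons_pair n : measurable_fun [set: T * n.-tuple T] (@cons_pair n).
Proof. exact: (measurable_cons measurable_fst measurable_snd). Qed.

HB.instance Definition _ n := isMeasurableFun.Build _ _ _ _ (@cons_pair n)
  (@measurable_cons_pair n).

Fixpoint prod_probability (n : nat) :
    ('I_n -> probability T R) -> probability (n.-tuple T) R :=
  match n with
  | 0 => fun=> \d_ [tuple]
  | n'.+1 => fun P => distribution
      (P ord0 \x prod_probability (fun i => P (lift ord0 i)))
      (@cons_pair n')
  end.

Lemma prod_probabilityE (n : nat) (P : 'I_n -> probability T R)
    (A : 'I_n -> set T) : (forall i, measurable (A i)) ->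
  prod_probability P [set x | forall i, A i (tnth x i)] = \prod_i P i (A i).
Proof.
elim: n P A => [|n IHn] P A mA /=.
  by rewrite big_ord0 diracE mem_set// => -[].
rewrite big_ord_recl -IHn; last by move=> i; exact: mA.
rewrite -product_measure1E//; last first.
  rewrite [X in measurable X](_ : _ = \bigcap_(i in [set: 'I_n])
      ((@tnth n T ^~ i) @^-1` A (lift ord0 i))).
    apply: fin_bigcap_measurable => // i _.
    by rewrite -[X in measurable X]setTI; exact: measurable_tnth.
  by apply/seteqP; split => x /= Ax i => [_|]; exact: Ax.
rewrite /distribution /pushforward; congr (_ _).
apply/seteqP; split => -[t x] /= => [Ax|[At Ax] i].
  split; first exact: (Ax ord0).
  by move=> i; have := Ax (lift ord0 i); rewrite tnthS.
by case: (unliftP ord0 i) => [j ->|->//]; rewrite tnthS.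
Qed.

End product_probability.

Section dynamics.
Context {d : measure_display} {T : measurableType d} {R : realType}.

Definition measure_preserving (mu : {measure set T -> \bar R}) (f : T -> T) :=
  measurable_fun [set: T] f /\
  forall A, measurable A -> mu (f @^-1` A) = mu A.

Definition mixing (mu : {measure set T -> \bar R}) (f : T -> T) :=
  forall A B, measurable A -> measurable B ->
    mu ((iter n f @^-1` A) `&` B) @[n --> \oo] --> (mu A * mu B)%E.

Definition has_Lp_density (lam mu : {measure set T -> \bar R}) :=
  exists (p : R) (h : T -> R),
    [/\ 1 < p, h \in Lfun lam p%:E, forall x, 0 <= h x &
        forall A, measurable A -> mu A = (\int[lam]_(x in A) (h x)%:E)%E].

End dynamics.

Definition hoelder_continuous (R : realType) (M : metricType R) (g : M -> R) :=
  exists alpha C : R, [/\ 0 < alpha, alpha <= 1 &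
    forall x y, `|g x - g y| <= C * mdist x y `^ alpha].

(* The library norm on ['rV[R]_d] is the sup norm; it induces the same topology
   and Borel sets as the Euclidean distance below. *)
Section euclidean.
Context {R : realType} {d : nat}.
Implicit Types (A B : set 'rV[R]_d) (x y : 'rV[R]_d) (r s delta : R).

Definition edist x y : R := Num.sqrt (\sum_(i < d) (x ord0 i - y ord0 i) ^+ 2).

Definition open_eball x r : set 'rV[R]_d := [set y | edist x y < r].

Definition closed_eball x r : set 'rV[R]_d := [set y | edist x y <= r].

(* Extended-real valued, so that an unbounded set has diameter [+oo]; the
   extra [0] gives the empty set diameter [0]. *)
Definition diam A : \bar R :=
  ereal_sup (0%E |` [set (edist x y)%:E | x in A & y in A]).

Local Open Scope ereal_scope.

Definition hausdorff_content s delta A : \bar R :=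
  ereal_inf [set \sum_(i <oo) (diam (U i) `^ s) |
    U in [set U : nat -> set 'rV[R]_d |
      A `<=` \bigcup_i U i /\ forall i, diam (U i) <= delta%:E]].

Definition hausdorff_measure s A : \bar R :=
  ereal_sup [set hausdorff_content s delta A | delta in [set x | (0 < x)%R]].

(* The restriction to [0 < s] does not change the infimum and avoids the
   convention for [0 `^ 0]. *)
Definition hausdorff_dim A : \bar R :=
  ereal_inf [set s%:E | s in [set s | (0 < s)%R /\ hausdorff_measure s A = 0]].

(* A packing is a family, indexed by [D], of pairwise disjoint closed balls
   centred in [A] of radius at most [delta]; a ball of radius [r] has diameter
   [2 * r]. *)
Definition packing_content s delta A : \bar R :=
  ereal_sup [set z | exists (D : set nat) (c : nat -> 'rV[R]_d) (r : nat -> R),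
    [/\ forall i, D i -> A (c i) /\ (0 < r i <= delta)%R,
        trivIset D (fun i => closed_eball (c i) (r i)) &
        z = \esum_(i in D) ((2 * r i) `^ s)%:E]].

Definition packing_premeasure s A : \bar R :=
  ereal_inf [set packing_content s delta A | delta in [set x | (0 < x)%R]].

Definition packing_measure s A : \bar R :=
  ereal_inf [set \sum_(i <oo) packing_premeasure s (U i) |
    U in [set U : nat -> set 'rV[R]_d | A `<=` \bigcup_i U i]].

Definition packing_dim A : \bar R :=
  ereal_inf [set s%:E | s in [set s | (0 < s)%R /\ packing_measure s A = 0]].

Definition covering_number A delta : \bar R :=
  ereal_inf [set n%:R%:E | n in [set n : nat |
    exists U : 'I_n -> set 'rV[R]_d,
      (forall i, diam (U i) <= delta%:E) /\ A `<=` [set x | exists i, U i x]]].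

Definition upper_box_dim A : \bar R :=
  limf_esup (fun delta => lne (covering_number A delta) * ((- ln delta)^-1)%:E)
            (0%R^'+).

(* With [A] empty the condition would hold for every map. *)
Definition class_Im (g : 'rV[R]_d -> 'rV[R]_d) :=
  exists A, [/\ A !=set0, compact A, g @` A `<=` A &
    forall B, compact B -> B `<=` A ->
      diam (iter n g @` B) @[n --> \oo] --> 0].

End euclidean.

(* A word of [D_k] is a [k.-tuple 'I_q]; levels are numbered from 1, so the
   letter at position [j < k] is used at level [j.+1].  Values of level-indexed
   families at level 0 are irrelevant. *)
Section moran.
Context {R : realType} {d q : nat}.
Variables (tri : set 'rV[R]_d) (f : nat -> 'I_q -> 'rV[R]_d -> 'rV[R]_d).

Definition word_map k (w : k.-tuple 'I_q) : 'rV[R]_d -> 'rV[R]_d :=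
  \big[(fun g h => g \o h)/id]_(j < k) f j.+1 (tnth w j).

Definition cell k (w : k.-tuple 'I_q) : set 'rV[R]_d := word_map w @` tri.

Definition moran_structure :=
  [/\ compact tri,
      forall k j, (1 <= k)%N -> class_Im (f k j),
      forall k (w : k.-tuple 'I_q), compact (cell w),
      forall k (w : k.-tuple 'I_q) j, cell [tuple of rcons w j] `<=` cell w &
      (\big[maxe/0%E]_(w : k.-tuple 'I_q) diam (cell w)) @[k --> \oo] --> 0%E].

Definition moran_set : set 'rV[R]_d :=
  \bigcap_k \bigcup_(w in [set: k.-tuple 'I_q]) cell w.

Definition is_GMS := moran_structure /\
  forall k (w w' : k.-tuple 'I_q), w <> w' ->
    cell w `&` cell w' `&` moran_set = set0.

(* The sequence [(i_1, i_2, ...)] is [code] with [code j] standing for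
   [i_(j+1)]. *)
Definition prefix_word (code : nat -> 'I_q) k : k.-tuple 'I_q :=
  [tuple code j | j < k].

Definition is_coding (y : 'rV[R]_d) (code : nat -> 'I_q) :=
  \bigcap_k cell (prefix_word code k) = [set y].

Variable c : nat -> 'I_q -> R.

Definition Psi k (w : k.-tuple 'I_q) : R := \prod_(j < k) c j.+1 (tnth w j).

Definition basic := (ereal_sup
  [set z | exists k j, (1 <= k)%N /\ z = (c k j)%:E] < 1%:E)%E.

Definition UE := exists2 C : R, 0 < C &
  forall k (w : k.-tuple 'I_q), (1 <= k)%N -> (diam (cell w) <= (C * Psi w)%:E)%E.

Definition cylinder k (w : k.-tuple 'I_q) : set 'rV[R]_d :=
  [set z | moran_set z /\
     exists2 code, is_coding z code & prefix_word code k = w].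

Definition moran_covering (r : R) : set (set 'rV[R]_d) :=
  [set A | exists (y : 'rV[R]_d) (code : nat -> 'I_q) (n : nat),
    [/\ moran_set y, is_coding y code,
        r < Psi (prefix_word code n), Psi (prefix_word code n.+1) <= r &
        A = cylinder (prefix_word code n)]].

Definition LE := exists M0 : nat,
  forall (y : 'rV[R]_d) (r : R), moran_set y -> 0 < r < 1 ->
    exists2 N : nat, (N < M0)%N &
      ([set A | moran_covering r A /\ A `&` open_eball y r !=set0] #= `I_N)%card.

Definition A3 := forall beta : R, 0 < beta ->
  exists (m : probability (borelType 'rV[R]_d) R) (L : R),
    [/\ m moran_set = 1%E, 0 < L &
        forall k (w : k.-tuple 'I_q), (1 <= k)%N ->
          L^-1 / (\sum_(w' : k.-tuple 'I_q) Psi w' `^ beta)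
            <= fine (m (cell w)) / Psi w `^ beta
            <= L / (\sum_(w' : k.-tuple 'I_q) Psi w' `^ beta)].

End moran.

Definition orbit_ratio (R : realType) (q : nat) (M : Type)
    (T : 'I_q -> M -> M) (phi : 'I_q -> M -> R) (x : q.-tuple M)
    (k : nat) (i : 'I_q) : R :=
  phi i (iter k (T i) (tnth x i)).

(* Main.v *)
Require Import Defs.
From mathcomp Require Import all_boot all_order all_algebra.
From mathcomp Require Import finmap all_classical all_reals all_analysis.
From mathcomp Require Import measurable_realfun lra ring zify.
Import Order.TTheory GRing.Theory Num.Theory.
Import numFieldNormedType.Exports.
Local Open Scope classical_set_scope.
Local Open Scope ring_scope.

(** The proof has a probabilistic half, which determines for almost every [x]
    the growth of the sums [Z_k(t) = \sum_(w in D_k) Psi w `^ t], and a geometric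
    half, which reads the three dimensions of [F] off that growth.

    Summing over words factorizes: [Z_k(t)] is the product over the levels
    [j <= k] of [\sum_i phi_i (T_i^j x_i) `^ t] ([sum_Psi_powR]), so [ln Z_k(t)]
    is a Birkhoff sum, along the product map on [M^q], of the function
    [ln (\sum_i phi_i (x_i) `^ t)]. A product of mixing systems is mixing
    ([mixing_prod_probability]), and the integral of that function, the pressure
    [P(t)], is continuous and strictly decreasing with a zero [s >= 0]
    ([pressure_lt], [pressure_zero]). The ergodic theorem enters only through
    one consequence of the maximal ergodic inequality: for a mixing map, the
    Birkhoff sums of a bounded function with negative integral are almost surely
    bounded above ([birkhoff_bounded_above]). Applied to the function itself for [t > s] and
    to its opposite for [t < s], it says that almost surely [Z_k(t)] is bounded
    in [k] for [t > s] and bounded away from [0] for [t < s]; by monotonicity in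
    [t], countably many [t] suffice.

    For any set, [dim_H <= dim_P] because a maximal family of disjoint balls
    of one radius becomes a cover when the radii are doubled
    ([hausdorff_dim_le_packing_dim]). For a nonempty set, [dim_P <= dim_B]
    because the covering
    number at scale [2^-k] bounds the number of disjoint balls whose radii lie
    between [2^-k] and [2^(1-k)] ([packing_dim_le_upper_box_dim]). It remains
    to show [dim_B F <= s <= dim_H F].

    For the upper bound, the ratios lie in an interval [[a, b]] with [0 < a] and
    [b < 1], by compactness of [M]. Bounded [Z_k] for one exponent makes
    [\sum_k Z_k(t)] converge for every larger exponent [t], and the cells [w]
    with [a r <= Psi w <= r] cover [F], have diameter [O(r)] by (UE), and number
    [O(r^-t)] ([covering_number_moran_le]). For the lower bound, if [Z_k(t)] is
    bounded below then (A3) with [beta = t] yields a measure giving each cell at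
    most a constant times [Psi w `^ t], and (LE) covers the part of [F] in a ball
    of radius [r] by boundedly many cells with [Psi w <= r / a]; so balls have
    measure [O(r^t)] ([moran_ball_mass]) and the mass distribution principle
    applies ([hausdorff_measure_gt0]). *)

Set Implicit Arguments.
Unset Strict Implicit.
Unset Printing Implicit Defensive.

Local Notation edist := Defs.edist.

(** * Finite products of reals *)

Lemma powR_prod (R : realType) (I : Type) (J : seq I) (F : I -> R) (s : R) :
  (forall i, 0 <= F i) ->
  (\prod_(i <- J) F i) `^ s = \prod_(i <- J) F i `^ s.
Proof.
move=> F0; elim: J => [|i J IH]; first by rewrite !big_nil powR1.
by rewrite !big_cons powRM ?IH// prodr_ge0.
Qed.

Lemma ln_prod (R : realType) (I : Type) (J : seq I) (F : I -> R) :
  (forall i, 0 < F i) -> ln (\prod_(i <- J) F i) = \sum_(i <- J) ln (F i).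
Proof.
move=> F0; elim: J => [|i J IH]; first by rewrite !big_nil ln1.
by rewrite !big_cons lnM ?IH// posrE// prodr_gt0.
Qed.

(** * Products of mixing systems *)

Section measure_convergence.
Context {d : measure_display} {T : measurableType d} {R : realType}.

Lemma dominated_measure_fin_num (m : probability T R)
    (l : {measure set T -> \bar R}) :
  (forall A, measurable A -> (l A <= m A)%E) ->
  forall A, measurable A -> l A \is a fin_num.
Proof.
move=> lm A mA; rewrite ge0_fin_numE; last exact: measure_ge0.
by rewrite (le_lt_trans (lm _ mA))// (le_lt_trans (probability_le1 _ mA))// ltry.
Qed.

Lemma fine_measure_split (m : probability T R)
    (l : {measure set T -> \bar R}) :
  (forall A, measurable A -> (l A <= m A)%E) ->
  forall A B, measurable A -> measurable B -> B `<=` A ->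
  fine (l A) = fine (l B) + fine (l (A `\` B)).
Proof.
move=> lm A B mA mB BA; have lf := dominated_measure_fin_num lm.
have mAB := measurableD mA mB.
rewrite -fineD ?lf// -measureU//; last by rewrite setIC setDKI.
by rewrite setDUK.
Qed.

Lemma fine_measure_bigsetU (m : probability T R)
    (l : {measure set T -> \bar R}) :
  (forall A, measurable A -> (l A <= m A)%E) ->
  forall (F : nat -> set T) N, (forall k, measurable (F k)) ->
  trivIset setT F ->
  fine (l (\big[setU/set0]_(i < N) F i)) = \sum_(i < N) fine (l (F i)).
Proof.
move=> lm F N mF tF.
rewrite measure_bigsetU// sum_fine// => i _.
exact: (dominated_measure_fin_num lm).
Qed.

Lemma cvg_finite_sum (f : nat -> nat -> R) (g : nat -> R) N :
  (forall i, f i n @[n --> \oo] --> g i) ->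
  \sum_(i < N) f i n @[n --> \oo] --> \sum_(i < N) g i.
Proof.
move=> fg; elim: N => [|N IH].
  by rewrite big_ord0; under eq_fun do rewrite big_ord0; exact: cvg_cst.
rewrite big_ord_recr/=; under eq_fun do rewrite big_ord_recr/=.
exact: cvgD.
Qed.

(** Tails of countable disjoint unions are small uniformly along the sequence,
    because all the measures are below the single finite measure [m]; hence the
    sets on which convergence holds form a Dynkin class. *)
Lemma cvg_measure_dynkin (m : probability T R)
    (m_ : nat -> {measure set T -> \bar R}) (l : {measure set T -> \bar R})
    (G : set (set T)) :
  @measurable _ T = <<s G >> -> setI_closed G ->
  (forall n A, measurable A -> (m_ n A <= m A)%E) ->
  (forall A, measurable A -> (l A <= m A)%E) ->
  fine (m_ n setT) @[n --> \oo] --> fine (l setT) ->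
  (forall A, G A -> fine (m_ n A) @[n --> \oo] --> fine (l A)) ->
  forall A, measurable A -> fine (m_ n A) @[n --> \oo] --> fine (l A).
Proof.
move=> mG GI m_m lm cT cG A mA.
pose P A := fine (m_ n A) @[n --> \oo] --> fine (l A).
suff GP : forall S, <<s G >> S -> P S by apply: GP; rewrite -mG.
apply: (dynkin_induction mG GI cT cG).
- move=> S mS PS; rewrite /P.
  have E (k : {measure set T -> \bar R}) :
      (forall A, measurable A -> (k A <= m A)%E) ->
      fine (k (~` S)) = fine (k setT) - fine (k S).
    by move=> km; rewrite (fine_measure_split km measurableT mS)// setTD; lra.
  rewrite (E _ lm); under eq_fun do rewrite (E _ (m_m _)).
  exact: cvgB.
- move=> F mF tF PF; rewrite /P.
  set A0 := \bigcup_k F k; pose A_ N := \big[setU/set0]_(i < N) F i.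
  have mA0 : measurable A0 by exact: bigcup_measurable.
  have mA_ N : measurable (A_ N) by exact: bigsetU_measurable.
  have A_A N : A_ N `<=` A0 by exact: bigsetU_bigcup.
  have S : \sum_(i < N) fine (m (F i)) @[N --> \oo] --> fine (m A0).
    have : \sum_(0 <= i < n) m (F i) @[n --> \oo] --> (fine (m A0))%:E.
      rewrite fineK ?fin_num_measure//.
      exact: measure_semi_sigma_additive.
    move=> /fine_cvgP[_].
    apply: cvg_trans; apply: near_eq_cvg; near=> N => /=.
    by rewrite big_mkord -sum_fine// => i _; rewrite fin_num_measure.
  apply/cvgrPdist_le => e e0.
  have e2 : 0 < e / 2 by rewrite divr_gt0.
  move/cvgrPdist_le : S => /(_ _ e2) [N _ /(_ N (leqnn N))] SN.
  have mm : forall A, measurable A -> (m A <= m A)%E by [].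
  have tail (k : {measure set T -> \bar R}) :
      (forall A, measurable A -> (k A <= m A)%E) ->
      0 <= fine (k (A0 `\` A_ N)) <= e / 2.
    move=> km; have mD := measurableD mA0 (mA_ N).
    rewrite fine_ge0//=.
    apply: (@le_trans _ _ (fine (m (A0 `\` A_ N)))).
      by apply: fine_le; rewrite ?(dominated_measure_fin_num km)
        ?fin_num_measure ?km.
    have := fine_measure_split mm mA0 (mA_ N) (A_A N).
    rewrite (fine_measure_bigsetU mm)//.
    by have := ler_norm (fine (m A0) - \sum_(i < N) fine (m (F i))); lra.
  have := @cvg_finite_sum (fun i n => fine (m_ n (F i)))
    (fun i => fine (l (F i))) N PF.
  move/cvgrPdist_le => /(_ _ e2); apply: filterS => n.
  rewrite (fine_measure_split (m_m n) mA0 (mA_ N) (A_A N)).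
  rewrite (fine_measure_split lm mA0 (mA_ N) (A_A N)).
  rewrite (fine_measure_bigsetU (m_m n))// (fine_measure_bigsetU lm)//.
  have /andP[] := tail _ lm; have /andP[] := tail _ (m_m n).
  rewrite !ler_norml => ? ? ? ? /andP[? ?]; apply/andP; split; lra.
Unshelve. all: by end_near. Qed.

End measure_convergence.

Section mixing.
Context {d : measure_display} {T : measurableType d} {R : realType}.
Implicit Types (m : probability T R) (f : T -> T).

Lemma measurable_iter f n :
  measurable_fun setT f -> measurable_fun setT (iter n f).
Proof.
move=> mf; elim: n => [|n IH]; first exact: measurable_id.
exact: (measurableT_comp mf IH).
Qed.

Lemma measurable_preimage_iter f n A :
  measurable_fun setT f -> measurable A -> measurable (iter n f @^-1` A).
Proof.
by move=> mf mA; rewrite -[X in measurable X]setTI; exact: measurable_iter.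
Qed.

Lemma measure_preserving_iter (m : {measure set T -> \bar R}) f n :
  measure_preserving m f -> measure_preserving m (iter n f).
Proof.
move=> [mf mpf]; split; first exact: measurable_iter.
elim: n => [|n IH] A mA //=.
rewrite -[RHS]mpf// -[RHS]IH//.
by rewrite -[X in measurable X]setTI; exact: mf.
Qed.

Lemma correlation_measure m (f : T -> T) B : measurable_fun setT f ->
  measurable B -> exists nu : {measure set T -> \bar R},
  forall A, nu A = m (f @^-1` A `&` B).
Proof.
move=> mf mB.
by unshelve eexists (pushforward (mrestr m mB) f : {measure set T -> \bar R}).
Qed.

Lemma mixing_fine m f : measure_preserving m f ->
  mixing m f <-> forall A B, measurable A -> measurable B ->
    fine (m ((iter n f @^-1` A) `&` B)) @[n --> \oo]
      --> fine (m A) * fine (m B).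
Proof.
move=> [mf _].
have mI n A B : measurable A -> measurable B ->
    measurable ((iter n f @^-1` A) `&` B).
  by move=> mA mB; apply: measurableI => //; exact: measurable_preimage_iter.
have mAB A B : measurable A -> measurable B ->
    (m A * m B)%E = (fine (m A) * fine (m B))%:E.
  by move=> mA mB; rewrite EFinM !fineK ?fin_num_measure.
split=> mix A B mA mB; have := mix A B mA mB; rewrite ?mAB//.
  by move=> /fine_cvgP[].
move=> h; apply: cvg_EFin => //.
by near=> n; rewrite fin_num_measure//; exact: mI.
Unshelve. all: by end_near. Qed.

(** Both arguments of the correlation are, the other being fixed, measures
    dominated by [m], so that the Dynkin class argument applies to one of them
    after the other. *)
Lemma mixing_generated m f (G : set (set T)) :
  @measurable _ T = <<s G >> -> setI_closed G -> measure_preserving m f ->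
  (forall A B, G A -> G B -> fine (m ((iter n f @^-1` A) `&` B)) @[n --> \oo]
      --> fine (m A) * fine (m B)) ->
  mixing m f.
Proof.
move=> mG GI mp GG; have [mf mpf] := mp.
have sG A : G A -> measurable A by move=> GA; rewrite mG; exact: sub_sigma_algebra.
have mpn n := (measure_preserving_iter n mp).2.
have mpre n A := @measurable_preimage_iter f n A mf.
have scale (r : R) : 0 <= r <= 1 -> exists2 l : {measure set T -> \bar R},
    (forall A, measurable A -> fine (l A) = fine (m A) * r) &
    (forall A, measurable A -> (l A <= m A)%E).
  move=> /andP[r0 r1].
  exists (mscale (NngNum r0) m : {measure set T -> \bar R}) => A mA.
    by rewrite /= /mscale/= fineM ?fin_num_measure// mulrC.
  by rewrite /= /mscale/= gee_pMl ?fin_num_measure// measure_ge0.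
have fine01 A : measurable A -> 0 <= fine (m A) <= 1.
  move=> mA; rewrite fine_ge0//= -lee_fin fineK ?fin_num_measure//.
  exact: probability_le1.
have GA B A : G B -> measurable A ->
    fine (m ((iter n f @^-1` A) `&` B)) @[n --> \oo] --> fine (m A) * fine (m B).
  move=> GB mA; have mB := sG _ GB.
  have [l lE lm] := scale _ (fine01 _ mB).
  have /choice[nu nuE] n := correlation_measure m (measurable_iter n mf) mB.
  rewrite -lE//; under eq_fun do rewrite -nuE.
  apply: (cvg_measure_dynkin mG GI _ lm) mA => //.
  - move=> n C mC; rewrite nuE -[X in (_ <= X)%E](mpn n)//.
    have mnC := mpre n _ mC.
    apply: le_measure; rewrite ?inE//; exact: measurableI.
  - rewrite lE// probability_setT mul1r; under eq_fun do rewrite nuE preimage_setT setTI.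
    exact: cvg_cst.
  - move=> C GC; rewrite lE//; last exact: sG.
    by under eq_fun do rewrite nuE; exact: GG.
apply/(mixing_fine mp) => A B mA mB.
have [l lE lm] := scale _ (fine01 _ mA).
have /choice[nu nuE] : forall n, exists nu : {measure set T -> \bar R},
    forall B, nu B = m ((iter n f @^-1` A) `&` B).
  move=> n; have [nu nuE] := correlation_measure m (@measurable_id _ T setT) (mpre n _ mA).
  by exists nu => C; rewrite nuE setIC.
rewrite mulrC -lE//; under eq_fun do rewrite -nuE.
apply: (cvg_measure_dynkin mG GI _ lm) mB => //.
- move=> n C mC; rewrite nuE; apply: le_measure; rewrite ?inE//.
  by apply: measurableI => //; exact: mpre.
- rewrite lE// probability_setT mul1r; under eq_fun do rewrite nuE setIT mpn//.
  exact: cvg_cst.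
- move=> C GC; rewrite lE//; last exact: sG.
  by rewrite mulrC; under eq_fun do rewrite nuE; exact: GA.
Qed.

Lemma mixing_invariant m f E : mixing m f -> measurable E ->
  f @^-1` E = E -> m E = 0%E \/ m E = 1%E.
Proof.
move=> mix mE fE.
have fnE n : iter n f @^-1` E = E.
  elim: n => [|n IH]//=; rewrite -[in RHS]IH -[in RHS]fE//.
have := mix _ _ mE mE; under eq_fun do rewrite fnE setIid.
move=> /(cvg_lim (@ereal_hausdorff R)); rewrite lim_cst// => mm.
have mEf : m E \is a fin_num by exact: fin_num_measure.
have e : fine (m E) = fine (m E) * fine (m E) by rewrite -fineM// -mm.
rewrite -(fineK mEf).
have /eqP : fine (m E) * (fine (m E) - 1) = 0 by lra.
by rewrite mulf_eq0 subr_eq0 => /orP[/eqP ->|/eqP ->]; [left|right].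
Qed.

End mixing.

Section mixing_product.
Context {R : realType}.

Definition map_pair (X Y : Type) (f : X -> X) (g : Y -> Y) (z : X * Y) :=
  (f z.1, g z.2).

Lemma iter_map_pair (X Y : Type) (f : X -> X) (g : Y -> Y) n z :
  iter n (map_pair f g) z = (iter n f z.1, iter n g z.2).
Proof. by elim: n => [|n IH]; [case: z|rewrite /= IH]. Qed.

Context {d1 d2 : measure_display} {X : measurableType d1}
  {Y : measurableType d2}.
Variables (P : probability X R) (Q : probability Y R).
Variables (f : X -> X) (g : Y -> Y).
Hypotheses (Pf : measure_preserving P f) (Qg : measure_preserving Q g).

Lemma measure_preserving_pair : measure_preserving (P \x Q)%E (map_pair f g).
Proof.
have [[mf pf] [mg pg]] := (Pf, Qg).
have mfg : measurable_fun setT (map_pair f g).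
  apply/measurable_fun_pairP; split => /=.
    exact: (measurableT_comp mf measurable_fst).
  exact: (measurableT_comp mg measurable_snd).
split=> // A mA.
have [nu nuE] : exists nu : {measure set (X * Y) -> \bar R},
   forall A, nu A = (P \x Q)%E (map_pair f g @^-1` A).
  by unshelve eexists (pushforward (P \x Q)%E (map_pair f g)).
transitivity (nu A); first by rewrite nuE.
apply: esym; apply: product_measure_unique => // B C mB mC.
rewrite nuE (_ : _ @^-1` _ = (f @^-1` B) `*` (g @^-1` C))//.
rewrite product_measure1E ?pf ?pg//.
- by rewrite -[X in measurable X]setTI; exact: mf.
- by rewrite -[X in measurable X]setTI; exact: mg.
Qed.

Lemma mixing_pair : mixing P f -> mixing Q g ->
  mixing (P \x Q)%E (map_pair f g).
Proof.
have [[mf pf] [mg pg]] := (Pf, Qg).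
move=> /(mixing_fine Pf) mixf /(mixing_fine Qg) mixg.
apply: (mixing_generated (measurable_prod_measurableType X Y)).
- move=> _ _ [A1 mA1 [A2 mA2 <-]] [B1 mB1 [B2 mB2 <-]].
  exists (A1 `&` B1); first exact: measurableI.
  exists (A2 `&` B2); first exact: measurableI.
  by rewrite setXI.
- exact: measure_preserving_pair.
move=> _ _ [A mA [B mB <-]] [C mC [D mD <-]].
have fE (K : set X) (L : set Y) : measurable K -> measurable L ->
    fine ((P \x Q)%E (K `*` L)) = fine (P K) * fine (Q L).
  by move=> mK mL; rewrite product_measure1E// fineM ?fin_num_measure.
rewrite !fE//.
rewrite (_ : (fun n => _) = (fun n => fine (P (iter n f @^-1` A `&` C)) *
                               fine (Q (iter n g @^-1` B `&` D)))).
  by rewrite mulrACA; apply: cvgM; [exact: mixf|exact: mixg].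
apply/funext => n; rewrite -fE.
- congr (fine (_ _)); rewrite setXI; congr (_ `&` _).
  by apply/seteqP; split=> -[u v] /=; rewrite iter_map_pair.
- by apply: measurableI => //; exact: measurable_preimage_iter.
- by apply: measurableI => //; exact: measurable_preimage_iter.
Qed.

End mixing_product.

Section mixing_tuple.
Context {R : realType}.

Section transfer.
Context {d1 d2 : measure_display} {Z : measurableType d1}
  {W : measurableType d2}.
Variables (P : probability Z R) (c : {mfun Z >-> W}).
Variables (f : Z -> Z) (g : W -> W).
Hypothesis gc : forall z, g (c z) = c (f z).

Lemma iter_conjugacy n z : iter n g (c z) = c (iter n f z).
Proof. by elim: n => [|n IH]//=; rewrite IH gc. Qed.

Lemma measure_preserving_distribution : measurable_fun setT g ->
  measure_preserving P f -> measure_preserving (distribution P c) g.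
Proof.
move=> mg [mf pf]; split=> // A mA; rewrite /distribution /pushforward.
rewrite -[RHS]pf; last by rewrite -[X in measurable X]setTI; exact: measurable_funPT.
by congr (P _); apply/seteqP; split=> z /=; rewrite gc.
Qed.

Lemma mixing_distribution : mixing P f -> mixing (distribution P c) g.
Proof.
move=> mix A B mA mB; rewrite /distribution /pushforward.
have mc (C : set W) : measurable C -> measurable (c @^-1` C).
  by move=> mC; rewrite -[X in measurable X]setTI; exact: measurable_funPT.
have := mix _ _ (mc _ mA) (mc _ mB); apply: cvg_trans; apply: near_eq_cvg.
near=> n; congr (P _); apply/seteqP; split=> z /=; rewrite iter_conjugacy//.
Unshelve. all: by end_near. Qed.

End transfer.

Context {d : measure_display} {X : measurableType d}.

Definition tuple_map n (T : 'I_n -> X -> X) (x : n.-tuple X) : n.-tuple X :=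
  [tuple T i (tnth x i) | i < n].

Lemma tnth_iter_tuple_map n (T : 'I_n -> X -> X) k x i :
  tnth (iter k (tuple_map T) x) i = iter k (T i) (tnth x i).
Proof. by elim: k => [|k IH]//=; rewrite tnth_mktuple IH. Qed.

Lemma measurable_tuple_map n (T : 'I_n -> X -> X) :
  (forall i, measurable_fun setT (T i)) -> measurable_fun setT (tuple_map T).
Proof.
move=> mT; apply/measurable_fun_tnthP => i /=.
rewrite (_ : _ \o _ = T i \o (@tnth n X)^~ i); last first.
  by apply/funext => x /=; rewrite tnth_mktuple.
exact: (measurableT_comp (mT i) (measurable_tnth i)).
Qed.

Lemma tuple_map_cons n (T : 'I_n.+1 -> X -> X) z :
  tuple_map T (cons_pair z) =
  cons_pair (map_pair (T ord0) (tuple_map (fun i => T (lift ord0 i))) z).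
Proof.
apply: eq_from_tnth => i; rewrite tnth_mktuple.
by case: (unliftP ord0 i) => [j ->|->//]; rewrite !tnthS tnth_mktuple.
Qed.

(** Prepending a coordinate conjugates the product of the first map with the
    remaining ones to the product of all of them; the induction starts from the
    one-point space of empty tuples. *)
Lemma mixing_prod_probability n (mu : 'I_n -> probability X R)
    (T : 'I_n -> X -> X) :
  (forall i, measure_preserving (mu i) (T i)) ->
  (forall i, mixing (mu i) (T i)) ->
  measure_preserving (prod_probability mu) (tuple_map T) /\
  mixing (prod_probability mu) (tuple_map T).
Proof.
elim: n mu T => [|n IH] mu T mp mx.
  have fA (f : 0.-tuple X -> 0.-tuple X) A : f @^-1` A = A.
    by apply/seteqP; split=> x /=; rewrite (tuple0 (f x)) (tuple0 x).
  split; first by split => [|A mA]; [apply: measurable_tuple_map => -[]|rewrite fA].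
  move=> A B mA mB; under eq_fun do rewrite fA.
  rewrite /= !diracE in_setI.
  by case: (_ \in A) => /=; rewrite ?mul1e ?mul0e; exact: cvg_cst.
have mpt := IH _ _ (fun i => mp (lift ord0 i)) (fun i => mx (lift ord0 i)).
split.
  apply: measure_preserving_distribution (@tuple_map_cons n T) _ _.
    by apply: measurable_tuple_map => i; have [] := mp i.
  by apply: measure_preserving_pair => //; exact: mpt.1.
apply: mixing_distribution (@tuple_map_cons n T) _.
by apply: mixing_pair => //; [exact: mpt.1|exact: mpt.2].
Qed.

End mixing_tuple.

(** * Boundedness of Birkhoff sums *)

Section birkhoff.
Context {d : measure_display} {T : measurableType d} {R : realType}.
Variables (m : probability T R) (f : T -> T) (g : T -> R) (b : R).
Hypotheses (mp : measure_preserving m f) (mix : mixing m f).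
Hypotheses (mg : measurable_fun setT g) (gb : forall x, `|g x| <= b).

(** The maximum of [0] and of the Birkhoff sums of length at most [n]. The
    recursion starts with a step of [f], so that it compares the value at [x]
    with the value at [f x]. *)
Fixpoint max_birkhoff_sum n x : R :=
  if n is k.+1 then Num.max 0 (g x + max_birkhoff_sum k (f x)) else 0.

Local Notation M := max_birkhoff_sum.

Lemma max_birkhoff_sum_ge0 n x : 0 <= M n x.
Proof. by case: n => [|n]//=; rewrite le_max lexx. Qed.

Lemma max_birkhoff_sum_le n x : M n x <= M n.+1 x.
Proof.
elim: n x => [|n IH] x; first exact: max_birkhoff_sum_ge0.
by rewrite /= le_max2//; move: (IH (f x)) => /=; lra.
Qed.

Lemma birkhoff_sum_le_max n x : \sum_(j < n) g (iter j f x) <= M n x.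
Proof.
elim: n x => [|n IH] x; first by rewrite big_ord0.
rewrite big_ord_recl /= le_max; apply/orP; right.
rewrite lerD2l (le_trans _ (IH (f x)))//.
by rewrite le_eqVlt; apply/orP; left; apply/eqP/eq_bigr => j _; rewrite -iterS iterSr.
Qed.

Lemma max_birkhoff_sum_bound n x : M n x <= b *+ n.
Proof.
elim: n x => [|n IH] x //=; have b0 : 0 <= b by rewrite (le_trans _ (gb x)).
rewrite ge_max mulrn_wge0//= mulrS lerD//.
by rewrite (le_trans (ler_norm _)).
Qed.

Lemma measurable_max_birkhoff_sum n : measurable_fun setT (M n).
Proof.
elim: n => [|n IH] /=; first exact: measurable_cst.
apply: measurable_maxr; first exact: measurable_cst.
by apply: measurable_funD => //; exact: (measurableT_comp IH mp.1).
Qed.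

Lemma bounded_integrable (h : T -> R) (c : R) : measurable_fun setT h ->
  (forall x, `|h x| <= c) -> m.-integrable setT (EFin \o h).
Proof.
move=> mh hc; apply: measurable_bounded_integrable => //.
  by rewrite (le_lt_trans (probability_le1 _ _))// ltry.
exists c; split; first exact: num_real.
by move=> y cy x _ /=; rewrite (le_trans (hc x))// ltW.
Qed.

Let pos n := [set x | 0 < M n.+1 x].

Let mgt n c : measurable [set x | c < M n x].
Proof.
rewrite (_ : mkset _ = M n @^-1` `]c, +oo[); last first.
  by apply/seteqP; split => x /=; rewrite in_itv/= andbT.
by rewrite -[X in measurable X]setTI; exact: measurable_max_birkhoff_sum.
Qed.

Let mpos n : measurable (pos n). Proof. exact: mgt. Qed.

(** Garsia's argument: where the maximum [M n.+1] is positive it equals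
    [g + M n \o f], hence [g] restricted to that set dominates
    [M n.+1 - M n \o f], whose integral is that of [M n.+1 - M n]. *)
Lemma maximal_ergodic n : (0 <= \int[m]_x (g x * \1_(pos n) x)%:E)%E.
Proof.
have Mint k : m.-integrable setT (EFin \o M k).
  apply: (@bounded_integrable _ (b *+ k)); first exact: measurable_max_birkhoff_sum.
  by move=> x; rewrite ger0_norm ?max_birkhoff_sum_ge0 ?max_birkhoff_sum_bound.
have Mfint k : m.-integrable setT (EFin \o (M k \o f)).
  apply: (@bounded_integrable _ (b *+ k)).
    exact: (measurableT_comp (measurable_max_birkhoff_sum k) mp.1).
  by move=> x /=; rewrite ger0_norm ?max_birkhoff_sum_ge0 ?max_birkhoff_sum_bound.
have gint : m.-integrable setT (EFin \o (fun x => g x * \1_(pos n) x)).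
  apply: (@bounded_integrable _ b).
    by apply: measurable_funM => //; exact: measurable_indic.
  move=> x; rewrite indicE; case: (_ \in _); rewrite ?mulr1 ?mulr0 ?normr0//.
  by rewrite (le_trans _ (gb x)).
have inv k : (\int[m]_x (M k (f x))%:E = \int[m]_x (M k x)%:E)%E.
  have := @ge0_integral_pushforward _ _ _ _ R f mp.1 m setT (EFin \o M k)
    measurableT.
  rewrite preimage_setT => <-.
  - by apply: eq_measure_integral => [|mf A mA _]; [exact: mp.1|exact: mp.2].
  - exact/measurable_EFinP/measurable_max_birkhoff_sum.
  - by move=> x _; rewrite /= lee_fin max_birkhoff_sum_ge0.
apply: (@le_trans _ _ (\int[m]_x ((M n.+1 x)%:E - (M n (f x))%:E))%E).
  rewrite (@integralB_EFin _ _ _ _ _ (M n.+1) (fun x => M n (f x)))//;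
    last exact: Mfint.
  rewrite inv sube_ge0; last first.
    by apply/orP; left; exact: integrable_fin_num (Mint n).
  apply: (le_integral measurableT (Mint n) (Mint n.+1)) => x _.
  by rewrite lee_fin max_birkhoff_sum_le.
apply: (le_integral measurableT (integrableB measurableT (Mint n.+1) (Mfint n))
  gint) => x _.
 rewrite -EFinB lee_fin indicE /=.
rewrite (_ : (x \in pos n) = (0 < Num.max 0 (g x + M n (f x)))); last first.
  by apply/idP/idP; rewrite inE.
have := max_birkhoff_sum_ge0 n (f x); rewrite lt_max ltxx /=.
by case: ltP => c; rewrite ?(max_r (ltW c)) ?(max_l c) /=; lra.
Qed.

(** The maxima [M n x] are unbounded in [n] on an invariant set, which has
    measure [0] or [1]. In the latter case the sets where [M n.+1] is positive
    exhaust the space, and the maximal inequality passes to the limit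
    [0 <= \int g]. *)
Lemma birkhoff_bounded_above : (\int[m]_x (g x)%:E < 0)%E ->
  {ae m, forall x, exists C, forall n, \sum_(j < n) g (iter j f x) <= C}.
Proof.
move=> g0.
pose E := \bigcap_k \bigcup_n [set x | (k%:R : R) < M n x].
have mE : measurable E.
  apply: bigcapT_measurable => k; apply: bigcupT_measurable => n.
  exact: mgt.
have fE : f @^-1` E = E.
  apply/seteqP; split => x Ex k _; have := gb x; rewrite ler_norml => /andP[gl gu].
    have [K kK] : exists K : nat, k%:R + b <= K%:R.
      exists (Num.bound (k%:R + b)); apply/ltW/archi_boundP.
      by rewrite addr_ge0// (le_trans _ (gb x)).
    have [N _ /= KN] := Ex K I.
    by exists N.+1 => //=; rewrite lt_max; apply/orP; right; lra.
  have [K kK] : exists K : nat, k%:R + b <= K%:R.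
    exists (Num.bound (k%:R + b)); apply/ltW/archi_boundP.
    by rewrite addr_ge0// (le_trans _ (gb x)).
  have [[|N] _ /= KN] := Ex K I; first by move: KN; rewrite ltNge ler0n.
  exists N => //=; move: KN; rewrite lt_max ltNge ler0n /=; lra.
have mE0 : m E = 0%E.
  have [//|E1] := mixing_invariant mix mE fE.
  exfalso; move: g0; apply/negP; rewrite -leNgt.
  have gint := bounded_integrable mg gb.
  have mind n : measurable_fun setT (fun x => g x * \1_(pos n) x).
    by apply: measurable_funM => //; exact: measurable_indic.
  have [|||||_ _ lim0] := @dominated_convergence _ T R m setT measurableT
    (fun n x => (g x * \1_(pos n) x)%:E) (EFin \o g) (cst b%:E).
  - by move=> n; exact/measurable_EFinP/mind.
  - exact/measurable_EFinP.
  - exists (~` E); split; first exact: measurableC.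
      by transitivity (1 - m E)%E; [exact: probability_setC|rewrite E1 subee].
    move=> x /= nx Ex; apply: nx => _.
    have [N _ MN] := Ex 0%N I.
    apply: cvg_near_cst; exists N => // n /= Nn.
    rewrite indicE mem_set ?mulr1//.
    apply: lt_le_trans MN _.
    by apply: (@homo_leq _ (fun k => M k x) (fun u v => u <= v)) (leqW Nn) => //;
      [exact: le_trans|move=> k; exact: max_birkhoff_sum_le].
  - exact: finite_measure_integrable_cst.
  - apply: aeW => x n _; rewrite lee_fin.
    rewrite indicE; case: (_ \in _); rewrite ?mulr1 ?mulr0 ?normr0//.
    by rewrite (le_trans _ (gb x)).
  rewrite -(cvg_lim (@ereal_hausdorff R) lim0); apply: lime_ge.
    by apply/cvg_ex; exists (\int[m]_x (g x)%:E)%E.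
  by near=> n; exact: maximal_ergodic.
exists E; split => // x /= nb k _; apply: contrapT => nE; apply: nb.
exists k%:R => n; apply: le_trans (birkhoff_sum_le_max n x) _.
by rewrite leNgt; apply/negP => kM; apply: nE; exists n.
Unshelve. all: by end_near. Qed.

End birkhoff.

(** * The pressure function *)

Section pressure.
Context {d : measure_display} {T : measurableType d} {R : realType}.
Variables (P : probability T R) (q : nat) (h : 'I_q -> T -> R) (a b : R).
Hypotheses (q0 : (0 < q)%N) (a0 : 0 < a) (b1 : b < 1).
Hypotheses (mh : forall i, measurable_fun setT (h i)).
Hypotheses (hab : forall i x, a <= h i x <= b).

Definition pressure_fun s x : R := ln (\sum_(i < q) h i x `^ s).

Let h0 i x : 0 < h i x.
Proof. by have /andP[/(lt_le_trans a0)] := hab i x. Qed.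

Let b0 : 0 < b.
Proof.
have /andP[ah hb] := hab (Ordinal q0) point.
exact: lt_le_trans a0 (le_trans ah hb).
Qed.

Lemma sum_powR_gt0 s x : 0 < \sum_(i < q) h i x `^ s.
Proof.
rewrite (bigD1 (Ordinal q0))//= ltr_wpDr ?powR_gt0//.
by apply: sumr_ge0 => i _; exact: powR_ge0.
Qed.

(** Each [h i x `^ u] lies between [a `^ u] and [b `^ u]. *)
Lemma pressure_fun_increment s u x : 0 <= u ->
  pressure_fun s x + u * ln a <= pressure_fun (s + u) x
    <= pressure_fun s x + u * ln b.
Proof.
move=> u0; have S0 := sum_powR_gt0 s x; have Su := sum_powR_gt0 (s + u) x.
rewrite /pressure_fun -!ln_powR -!lnM ?posrE ?powR_gt0//.
have E i : h i x `^ (s + u) = h i x `^ s * h i x `^ u.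
  by rewrite powRD// (gt_eqF (h0 _ _)) implybT.
rewrite !ler_ln ?posrE ?mulr_gt0 ?powR_gt0// !mulr_suml.
apply/andP; split; apply: ler_sum => i _; rewrite E ler_wpM2l ?powR_ge0//;
  have /andP[ah hb] := hab i x.
- by apply: ge0_ler_powR => //; rewrite nnegrE ltW.
- by apply: ge0_ler_powR => //; rewrite nnegrE ltW.
Qed.

Lemma measurable_pressure_fun s : measurable_fun setT (pressure_fun s).
Proof.
apply: measurableT_comp => //; apply: measurable_sum => i.
exact: (measurableT_comp (measurable_powR s) (mh i)).
Qed.

Let ln_a : ln a <= ln b.
Proof.
have /andP[ah hb] := hab (Ordinal q0) point.
by rewrite ler_ln ?posrE// (le_trans ah).
Qed.

Let ln_b : ln b < 0. Proof. by rewrite ln_lt0// b0. Qed.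

Lemma pressure_fun0 x : pressure_fun 0 x = ln q%:R.
Proof.
rewrite /pressure_fun; under eq_bigr do rewrite powRr0.
by rewrite sumr_const card_ord.
Qed.

Lemma pressure_fun_bound s x :
  `|pressure_fun s x| <= ln q%:R + `|s| * - ln a.
Proof.
have lq : 0 <= ln q%:R :> R by rewrite ln_ge0// ler1n.
have [s0|s0] := leP 0 s.
  have := pressure_fun_increment 0 x s0; rewrite add0r pressure_fun0.
  have : s * ln a <= s * ln b by rewrite ler_wpM2l.
  have : s * ln b <= 0 by rewrite mulr_ge0_le0// ltW.
  by rewrite ler_norml (ger0_norm s0) mulrN => ? ? /andP[? ?]; apply/andP; split; lra.
have s0' : 0 <= - s by rewrite oppr_ge0 ltW.
have := pressure_fun_increment s x s0'; rewrite subrr pressure_fun0.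
have : - s * ln a <= - s * ln b by rewrite ler_wpM2l.
have : - s * ln b <= 0 by rewrite mulr_ge0_le0// ltW.
by rewrite ler_norml (ltr0_norm s0) mulrN => ? ? /andP[? ?]; apply/andP; split; lra.
Qed.

Lemma integrable_pressure_fun s :
  P.-integrable setT (EFin \o pressure_fun s).
Proof.
exact: bounded_integrable (measurable_pressure_fun s) (pressure_fun_bound s).
Qed.

Definition pressure s : R := \int[P]_x pressure_fun s x.

Lemma pressureE s : (\int[P]_x (pressure_fun s x)%:E = (pressure s)%:E)%E.
Proof.
rewrite /pressure /Rintegral fineK//.
exact: integrable_fin_num (integrable_pressure_fun s).
Qed.

Lemma integral_pressure_shift s c :
  (\int[P]_x (pressure_fun s x + c)%:E = (pressure s + c)%:E)%E.
Proof.
under eq_integral do rewrite EFinD.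
rewrite integralD_EFin//; last 2 first.
- exact: integrable_pressure_fun.
- exact: finite_measure_integrable_cst.
rewrite pressureE integral_cst// EFinD; congr (_ + _)%E.
by rewrite -[RHS]mule1; congr (_ * _)%E; exact: probability_setT.
Qed.

Lemma pressure_increment s u : 0 <= u ->
  pressure s + u * ln a <= pressure (s + u) <= pressure s + u * ln b.
Proof.
move=> u0; rewrite -!lee_fin -!integral_pressure_shift -pressureE.
have shift c : P.-integrable setT (EFin \o (fun x => pressure_fun s x + c)).
  apply: (@bounded_integrable _ _ _ _ _ (ln q%:R + `|s| * - ln a + `|c|)).
    by apply: measurable_funD => //; exact: measurable_pressure_fun.
  move=> x; rewrite (le_trans (ler_normD _ _))// lerD2r.
  exact: pressure_fun_bound.
apply/andP; split.
  apply: (le_integral measurableT (shift _) (integrable_pressure_fun _)) => x _.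
  by rewrite lee_fin; have /andP[] := pressure_fun_increment s x u0.
apply: (le_integral measurableT (integrable_pressure_fun _) (shift _)) => x _.
by rewrite lee_fin; have /andP[] := pressure_fun_increment s x u0.
Qed.

Lemma pressure_lt s t : s < t -> pressure t < pressure s.
Proof.
move=> st; have u0 : 0 <= t - s by rewrite subr_ge0 ltW.
have /andP[_] := pressure_increment s u0; rewrite addrC subrK => /le_lt_trans; apply.
by rewrite gtrDl pmulr_rlt0// subr_gt0.
Qed.

Lemma continuous_pressure : continuous pressure.
Proof.
move=> s; apply/cvgrPdist_le => e e0.
have la : 0 < - ln a by rewrite oppr_gt0 (le_lt_trans ln_a).
near=> t.
have st : `|s - t| * - ln a <= e.
  rewrite -ler_pdivlMr//; near: t.
  by apply: (@cvgr_dist_le _ _ _ _ _ id s) => //; rewrite divr_gt0.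
have key u v : u <= v -> `|pressure u - pressure v| <= (v - u) * - ln a.
  move=> uv; have w0 : 0 <= v - u by rewrite subr_ge0.
  have := pressure_increment u w0; rewrite [u + _]addrC subrK.
  have : (v - u) * ln b <= 0 by rewrite mulr_ge0_le0// ltW.
  by rewrite ler_norml mulrN => ? /andP[? ?]; apply/andP; split; lra.
have [ts|/ltW ts] := leP s t.
  by rewrite (le_trans (key _ _ ts))// (le_trans _ st)// distrC ger0_norm// subr_ge0.
by rewrite distrC (le_trans (key _ _ ts))// (le_trans _ st)// ger0_norm// subr_ge0.
Unshelve. all: by end_near. Qed.

(** The pressure equals [ln q >= 0] at [0] and decreases at least at the rate
    [- ln b > 0]. *)
Lemma pressure_zero : exists s, 0 <= s /\ pressure s = 0.
Proof.
have P0 : pressure 0 = ln q%:R.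
  rewrite /pressure /Rintegral; under eq_integral do rewrite pressure_fun0.
  by rewrite integral_cst//= probability_setT mule1.
have lq : 0 <= ln q%:R :> R by rewrite ln_ge0// ler1n.
pose t : R := ln q%:R / - ln b.
have t0 : 0 <= t by rewrite divr_ge0// oppr_ge0 ltW.
have Pt : pressure t <= 0.
  have /andP[_] := pressure_increment 0 t0; rewrite add0r P0 => /le_trans; apply.
  by rewrite /t invrN mulrN mulNr divfK ?subrr// lt_eqF.
have [] := @IVT R pressure 0 t 0 t0.
- exact/continuous_subspaceT/continuous_pressure.
- by rewrite P0 ge_min le_max lq Pt orbT.
- by move=> s; rewrite in_itv/= => /andP[s0 _] Ps; exists s.
Qed.

End pressure.

(** * Hausdorff and packing dimensions *)

Section euclidean_distance.
Context {R : realType} {d : nat}.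
Implicit Types (A B : set 'rV[R]_d) (x y z : 'rV[R]_d) (r s : R).

Lemma edist_ge0 x y : 0 <= edist x y.
Proof. exact: sqrtr_ge0. Qed.

Lemma edistC x y : edist x y = edist y x.
Proof.
by congr Num.sqrt; apply: eq_bigr => i _; rewrite -[RHS]sqrrN opprB.
Qed.

Lemma edistxx x : edist x x = 0.
Proof.
rewrite /edist big1 ?sqrtr0// => i _; by rewrite subrr expr0n.
Qed.

Lemma edist_eq0 (x y : 'rV[R]_d) : edist x y = 0 -> x = y.
Proof.
rewrite /edist => /eqP; rewrite sqrtr_eq0 => S0.
apply/rowP => i; apply/eqP; rewrite -subr_eq0 -sqrf_eq0 eq_le sqr_ge0 andbT.
by rewrite (le_trans _ S0)// (bigD1 i)//= lerDl sumr_ge0// => j _; exact: sqr_ge0.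
Qed.

(** The bound [(u + v)^2 <= 2 u^2 + 2 v^2], applied to each coordinate, settles
    the only case of the triangle inequality used below, that of two equal
    radii. *)
Lemma edist_le2 r x y z : edist x y <= r -> edist y z <= r ->
  edist x z <= 2 * r.
Proof.
move=> xy yz; have r0 : 0 <= r by rewrite (le_trans (edist_ge0 x y)).
have sq u v : edist u v <= r -> \sum_(i < d) (u ord0 i - v ord0 i) ^+ 2 <= r ^+ 2.
  move=> uv; rewrite -[leLHS]sqr_sqrtr; last by apply: sumr_ge0 => i _; exact: sqr_ge0.
  by rewrite lerXn2r// ?nnegrE ?sqrtr_ge0.
rewrite -[leRHS]ger0_norm ?mulr_ge0// -sqrtr_sqr ler_sqrt ?sqr_ge0//.
apply: (@le_trans _ _ (2 * r ^+ 2 + 2 * r ^+ 2)); last by rewrite exprMn; lra.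
apply: (@le_trans _ _ (2 * (\sum_(i < d) (x ord0 i - y ord0 i) ^+ 2) +
                        2 * (\sum_(i < d) (y ord0 i - z ord0 i) ^+ 2))).
  rewrite !mulr_sumr -big_split/=; apply: ler_sum => i _.
  rewrite -subr_ge0 (_ : _ - _ = (x ord0 i - 2 * y ord0 i + z ord0 i) ^+ 2).
    exact: sqr_ge0.
  by ring.
by rewrite lerD// ler_wpM2l ?sq.
Qed.

Lemma diam_ge0 A : (0 <= diam A)%E.
Proof. by apply: ereal_sup_ubound; left. Qed.

Lemma edist_le_diam A x y : A x -> A y -> ((edist x y)%:E <= diam A)%E.
Proof. by move=> Ax Ay; apply: ereal_sup_ubound; right; exists x => //; exists y. Qed.

Lemma diam_le A r : 0 <= r -> (forall x y, A x -> A y -> edist x y <= r) ->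
  (diam A <= r%:E)%E.
Proof.
move=> r0 Ar; apply: ge_ereal_sup => _ [->|[x Ax [y Ay <-]]]; rewrite lee_fin//.
exact: Ar.
Qed.

Lemma diam_set0 : diam (@set0 'rV[R]_d) = 0%E.
Proof. by apply/eqP; rewrite eq_le diam_ge0 diam_le. Qed.

Lemma diam_closed_eball x r : 0 <= r -> (diam (closed_eball x r) <= (2 * r)%:E)%E.
Proof.
move=> r0; apply: diam_le => [|y z /= xy xz]; first by rewrite mulr_ge0.
by apply: edist_le2 xz; rewrite edistC.
Qed.

Lemma diam_poweR_le A r s : 0 <= s -> (diam A <= r%:E)%E ->
  (diam A `^ s <= (r `^ s)%:E)%E.
Proof.
move=> s0 Ar; rewrite -poweR_EFin; have A0 := diam_ge0 A.
by apply: gt0_ler_poweR => //; rewrite in_itv/= ?A0 ?leey// (le_trans A0).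
Qed.

End euclidean_distance.

Section hausdorff_packing.
Context {R : realType} {d : nat}.
Implicit Types (A B : set 'rV[R]_d) (x y z : 'rV[R]_d) (s r delta : R).
Local Open Scope ereal_scope.

Let hausdorff_cost s delta (U : set 'rV[R]_d) : \bar R :=
  if diam U <= delta%:E then diam U `^ s else +oo.

Let hausdorff_cost_ge0 s delta U : 0 <= hausdorff_cost s delta U.
Proof. by rewrite /hausdorff_cost; case: ifP => // _; rewrite poweR_ge0. Qed.

(** The Hausdorff content is the outer measure generated by the cost
    [diam U `^ s], made infinite on sets that are too large; every set is
    admitted in the covers, whence the discrete sigma-algebra. *)
Lemma hausdorff_content_mu_ext s delta A :
  hausdorff_content s delta A =
  @mu_ext _ (g_sigma_algebraType [set: set 'rV[R]_d]) R
    (hausdorff_cost s delta) A.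
Proof.
apply/eqP; rewrite eq_le; apply/andP; split; apply: le_ereal_inf_tmp => _ [U [h1 h2] <-].
  have [Ud|/existsNP[i /negP Ui]] := pselect (forall i, diam (U i) <= delta%:E).
    apply: ereal_inf_lbound; exists U => //.
    by apply: eq_eseriesr => i _; rewrite /hausdorff_cost Ud.
  rewrite (@nneseries_pinfty _ _ xpredT i) ?leey//.
  by rewrite /hausdorff_cost (negbTE Ui).
apply: ereal_inf_lbound; exists U.
  by split=> // i; apply: sub_sigma_algebra.
by apply: eq_eseriesr => i _; rewrite /hausdorff_cost h2.
Qed.

Lemma hausdorff_content_ge0 s delta A : 0 <= hausdorff_content s delta A.
Proof.
rewrite hausdorff_content_mu_ext; apply: mu_ext_ge0.
exact: hausdorff_cost_ge0.
Qed.

Lemma hausdorff_content_subadditive s delta A (U : nat -> set 'rV[R]_d) :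
  A `<=` \bigcup_i U i ->
  hausdorff_content s delta A <= \sum_(i <oo) hausdorff_content s delta (U i).
Proof.
move=> AU; under eq_eseriesr do rewrite hausdorff_content_mu_ext.
rewrite hausdorff_content_mu_ext; apply: le_trans (mu_ext_sigma_subadditive _ _).
  exact: le_mu_ext.
exact: hausdorff_cost_ge0.
Qed.

Lemma le_hausdorff_content s delta delta' A : (delta <= delta')%R ->
  hausdorff_content s delta' A <= hausdorff_content s delta A.
Proof.
move=> dd; apply: ereal_inf_le_tmp => _ [U [AU Ud] <-]; exists U => //.
by split=> // i; rewrite (le_trans (Ud i))// lee_fin.
Qed.

Lemma hausdorff_content_le_finite_cover s delta N A
    (U : 'I_N -> set 'rV[R]_d) : (0 < s)%R -> (0 <= delta)%R ->
  (forall i, diam (U i) <= delta%:E) -> A `<=` [set x | exists i, U i x] ->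
  hausdorff_content s delta A <= \sum_(i < N) (diam (U i) `^ s).
Proof.
move=> s0 d0 Ud AU; apply: ereal_inf_lbound.
pose V k := if insub k is Some i then U i else set0.
have V_ge k : (N <= k)%N -> V k = set0.
  by move=> Nk; rewrite /V; case: insubP => // i; rewrite ltnNge Nk.
exists V; first split.
- by move=> x /AU[i Uix]; exists i => //; rewrite /V valK.
- by move=> k; rewrite /V; case: insubP => // _; rewrite diam_set0 lee_fin.
rewrite (nneseries_split 0 N) => [|k _]; last exact: poweR_ge0.
rewrite add0n eseries0 ?adde0 => [|k Nk _]; last first.
  by rewrite V_ge// diam_set0 poweR0r ?gt_eqF.
by rewrite big_mkord; apply: eq_bigr => i _; rewrite /V valK.
Qed.

Lemma packing_content_ge0 s delta A : 0 <= packing_content s delta A.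
Proof.
apply: ereal_sup_ubound; exists set0, (fun=> 0%R), (fun=> 0%R); split => //.
by rewrite esum_set0.
Qed.

Lemma le_packing_content s delta delta' A : (delta <= delta')%R ->
  packing_content s delta A <= packing_content s delta' A.
Proof.
move=> dd; apply: ereal_sup_le => _ [D [c [r [Dc tD ->]]]].
exists D, c, r; split => // i Di; have [Ac /andP[r0 rd]] := Dc i Di.
by split=> //; rewrite r0 (le_trans rd).
Qed.

(** A maximal family of disjoint balls of one radius exists as soon as the
    packing content is finite, since each ball contributes the same amount;
    doubling the radii then yields a cover. *)
Lemma maximal_packing s rho A : (0 < rho)%R ->
  packing_content s rho A < +oo ->
  exists N (c : nat -> 'rV[R]_d),
    A `<=` [set x | exists i : 'I_N, closed_eball (c i) (2 * rho) x] /\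
    (N%:R * (2 * rho) `^ s)%:E <= packing_content s rho A.
Proof.
move=> rho0 Poo.
pose Q N := exists c : nat -> 'rV[R]_d, (forall i, (i < N)%N -> A (c i)) /\
  trivIset `I_N (fun i => closed_eball (c i) rho).
have QP N : Q N -> (N%:R * (2 * rho) `^ s)%:E <= packing_content s rho A.
  move=> [c [cA tc]]; apply: ereal_sup_ubound; exists `I_N, c, (fun=> rho).
  split => // [i iN|]; first by split; [exact: cA|rewrite rho0 lexx].
  rewrite esum_fset//; last by move=> i _; rewrite lee_fin powR_ge0.
  by rewrite -fsbig_ord sumEFin sumr_const card_ord mulr_natl.
have Q0 : exists N, `[< Q N >] by exists 0%N; apply/asboolP; exists (fun=> 0%R); split.
have s0 : (0 < (2 * rho) `^ s)%R by rewrite powR_gt0// mulr_gt0.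
pose B := Num.bound (fine (packing_content s rho A) / (2 * rho) `^ s).
have Qb N : `[< Q N >] -> (N <= B)%N.
  move=> /asboolP/QP; have P0 := packing_content_ge0 s rho A.
  have Pf : packing_content s rho A \is a fin_num by rewrite ge0_fin_numE.
  rewrite -(fineK Pf) lee_fin -ler_pdivlMr// => NB.
  rewrite -(ler_nat R) (le_trans NB)// ltW// archi_boundP//.
  by rewrite divr_ge0// ?fine_ge0// ltW.
case: (ex_maxnP Q0 Qb) => N /asboolP QN maxN.
have NP := QP _ QN; have [c [cA tc]] := QN.
exists N, c; split=> // y Ay; apply: contrapT => far.
have : (N.+1 <= N)%N; last by rewrite ltnn.
apply/maxN/asboolP; exists (fun i => if (i < N)%N then c i else y); split.
  by move=> i _; case: ifPn => // iN; exact: cA.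
have ball_far i z : (i < N)%N -> closed_eball (c i) rho z ->
    closed_eball y rho z -> False.
  move=> iN /= cz yz; apply: far; exists (Ordinal iN) => /=.
  by apply: edist_le2 cz _; rewrite edistC.
move=> i j /= iN1 jN1 [z []]; case: ifPn => iN; case: ifPn => jN.
- by move=> ciz cjz; apply: tc => //; exists z.
- by move=> ciz yz; exfalso; exact: (ball_far i z).
- by move=> yz cjz; exfalso; exact: (ball_far j z).
by move=> _ _; lia.
Qed.

Lemma hausdorff_content_le_packing s rho A : (0 < s)%R -> (0 < rho)%R ->
  hausdorff_content s (4 * rho) A <= (2 `^ s)%:E * packing_content s rho A.
Proof.
move=> s0 rho0; have s2 : (0 < 2 `^ s :> R)%R by rewrite powR_gt0.
have [->|] := eqVneq (packing_content s rho A) +oo.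
  by rewrite gt0_muley ?leey// lte_fin.
rewrite -ltey => /(maximal_packing rho0)[N [c [Ac Nle]]].
apply: le_trans (_ : _ <= (2 `^ s)%:E * (N%:R * (2 * rho) `^ s)%:E) _; last first.
  by rewrite lee_pmul2l ?fin_numE// lte_fin.
apply: le_trans (hausdorff_content_le_finite_cover _ _ _ Ac) _ => //.
- by rewrite mulr_ge0// ltW.
- move=> i; rewrite (_ : 4 * rho = 2 * (2 * rho))%R; last by ring.
  by apply: diam_closed_eball; rewrite mulr_ge0// ltW.
rewrite (_ : _ * _ = \sum_(i < N) ((2 * (2 * rho)) `^ s)%:E); last first.
  rewrite sumEFin sumr_const card_ord -EFinM -[(_ *+ N)%R]mulr_natl.
  rewrite [((2 * (2 * rho)) `^ s)%R]powRM//.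
    by congr (_%:E); ring.
  by rewrite mulr_ge0// ltW.
apply: lee_sum => i _; apply: diam_poweR_le; first exact: ltW.
by apply: diam_closed_eball; rewrite mulr_ge0// ltW.
Qed.

Lemma hausdorff_measure_ge0 s A : 0 <= hausdorff_measure s A.
Proof.
apply: le_ereal_sup_tmp; exists (hausdorff_content s 1 A); last first.
  exact: hausdorff_content_ge0.
by exists 1%R => //=; exact: ltr01.
Qed.

(** The comparison is made on each piece of a cover of [A], at a scale that may
    depend on the piece, and the pieces are put together by the countable
    subadditivity of the Hausdorff content. *)
Lemma hausdorff_measure_le_packing s A : (0 < s)%R ->
  hausdorff_measure s A <= (2 `^ s)%:E * packing_measure s A.
Proof.
move=> s0; have s2 : (0 < 2 `^ s :> R)%R by rewrite powR_gt0.
have premeasure delta (B : set 'rV[R]_d) : (0 < delta)%R ->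
    hausdorff_content s delta B <= (2 `^ s)%:E * packing_premeasure s B.
  move=> d0; rewrite /packing_premeasure -ereal_inf_pZl//.
  apply: le_ereal_inf_tmp => _ [_ [eta /= eta0 <-] <-].
  pose rho := Num.min eta (delta / 4)%R.
  have rho0 : (0 < rho)%R by rewrite lt_min eta0 divr_gt0.
  apply: le_trans (_ : _ <= hausdorff_content s (4 * rho) B) _.
    apply: le_hausdorff_content.
    by rewrite mulrC -ler_pdivlMr// ge_min lexx orbT.
  apply: le_trans (hausdorff_content_le_packing _ s0 rho0) _.
  rewrite lee_pmul2l ?fin_numE// ?lte_fin//.
  by apply: le_packing_content; rewrite ge_min lexx.
apply: ge_ereal_sup => _ [delta /= d0 <-].
rewrite /packing_measure -ereal_inf_pZl//.
apply: le_ereal_inf_tmp => _ [_ [U AU <-] <-].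
apply: le_trans (hausdorff_content_subadditive _ _ AU) _.
rewrite -nneseriesZl => [|i _]; last first.
  by apply: le_ereal_inf_tmp => _ [eta _ <-]; exact: packing_content_ge0.
apply: lee_nneseries => [i *|i *]; first exact: hausdorff_content_ge0.
exact: premeasure.
Qed.

Lemma hausdorff_dim_le_packing_dim A : hausdorff_dim A <= packing_dim A.
Proof.
apply: ereal_inf_le_tmp => _ [s [s0 Ps] <-]; exists s => //; split=> //.
apply/eqP; rewrite eq_le hausdorff_measure_ge0 andbT.
by rewrite (le_trans (hausdorff_measure_le_packing _ s0))// Ps mule0.
Qed.

End hausdorff_packing.

(** * Packing and box dimensions *)

Section box_dimension.
Context {R : realType} {d : nat}.
Implicit Types (A B : set 'rV[R]_d) (s t r delta e : R).

Lemma covering_number_ge0 A delta : (0 <= covering_number A delta)%E.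
Proof. by apply: le_ereal_inf_tmp => _ [n _ <-]; rewrite lee_fin. Qed.

Lemma covering_number_ge1 A delta : A !=set0 -> (1 <= covering_number A delta)%E.
Proof.
move=> [x Ax]; apply: le_ereal_inf_tmp => _ [n [U [_ AU]] <-].
by have [i _] := AU _ Ax; rewrite lee_fin ler1n (leq_ltn_trans _ (ltn_ord i)).
Qed.

Lemma near_at_right0 (V : set R) : (0%R^'+ : set_system R) V ->
  exists2 e, 0 < e <= 1 & forall x, 0 < x -> x < e -> V x.
Proof.
rewrite /at_right /within /= => /nbhs_ballP[e /= e0 eV].
exists (Num.min e 1); first by rewrite lt_min e0 ltr01 ge_min lexx orbT.
move=> x x0; rewrite lt_min => /andP[xe _]; apply: (eV x) => //.
by rewrite /ball/= sub0r normrN gtr0_norm.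
Qed.

Lemma at_right0_near (V : set R) e : 0 < e ->
  (forall x, 0 < x -> x < e -> V x) -> (0%R^'+ : set_system R) V.
Proof.
move=> e0 eV; near=> x; apply: eV; first by near: x; exact: nbhs_right_gt.
by near: x; exact: nbhs_right_lt.
Unshelve. all: by end_near. Qed.

Lemma covering_exponentE A delta t : 0 < delta < 1 ->
  (lne (covering_number A delta) * ((- ln delta)^-1)%:E <= t%:E)%E =
  (covering_number A delta <= (delta `^ (- t))%:E)%E.
Proof.
move=> /andP[d0 d1]; have ld : 0 < - ln delta by rewrite oppr_gt0 ln_lt0// d0.
rewrite -(@lee_lne R (covering_number A delta)); last 2 first.
- by rewrite in_itv/= covering_number_ge0 leey.
- by rewrite in_itv/= lee_fin powR_ge0 leey.
rewrite [lne (_%:E)]/= (lt_geF (powR_gt0 (- t) d0)) ln_powR.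
rewrite lee_pdivrMr// -EFinM; congr (_ <= _%:E)%E; lra.
Qed.

Lemma upper_box_dim_le A t e : 0 < e ->
  (forall delta, 0 < delta -> delta < e ->
    (covering_number A delta <= (delta `^ (- t))%:E)%E) ->
  (upper_box_dim A <= t%:E)%E.
Proof.
move=> e0 At; rewrite /upper_box_dim limf_esupE; apply: ge_ereal_inf.
pose V := [set x : R | 0 < x < Num.min e 1].
exists (ereal_sup [set (lne (covering_number A x) * ((- ln x)^-1)%:E)%E | x in V]).
  exists V => //; apply: (@at_right0_near _ (Num.min e 1)).
    by rewrite lt_min e0 ltr01.
  by move=> x x0 xe; rewrite /V/= x0.
apply: ge_ereal_sup => _ [x /= /andP[x0 xm] <-].
have /andP[xe x1] : (x < e) && (x < 1) by rewrite -lt_min.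
by rewrite covering_exponentE ?x0// At.
Qed.

(** A multiplicative constant is absorbed by any increase of the exponent. *)
Lemma upper_box_dim_le_growth A t t' K e : 0 < e -> 0 < K -> t < t' ->
  (forall delta, 0 < delta -> delta < e ->
    (covering_number A delta <= (K * delta `^ (- t))%:E)%E) ->
  (upper_box_dim A <= t'%:E)%E.
Proof.
move=> e0 K0 tt' At; have u0 : 0 < t' - t by rewrite subr_gt0.
(* below the radius [v], the factor [delta `^ (t - t')] is at least [K] *)
pose v := K^-1 `^ (t' - t)^-1.
have v0 : 0 < v by rewrite powR_gt0// invr_gt0.
apply: (@upper_box_dim_le _ _ (Num.min e v)); first by rewrite lt_min e0.
move=> delta d0; rewrite lt_min => /andP[de dv].
apply: le_trans (At _ d0 de) _; rewrite lee_fin.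
have -> : - t' = - (t' - t) + - t by lra.
rewrite powRD; last by rewrite (gt_eqF d0) implybT.
rewrite ler_wpM2r ?powR_ge0// powRN.
rewrite -[leLHS]invrK lef_pV2 ?posrE ?invr_gt0 ?powR_gt0//.
have -> : K^-1 = v `^ (t' - t).
  by rewrite /v -powRrM mulVf ?gt_eqF// powRr1// invr_ge0 ltW.
by apply: ge0_ler_powR; rewrite ?nnegrE ?ltW.
Qed.

Lemma upper_box_dim_lt A t : (upper_box_dim A < t%:E)%E ->
  exists2 e, 0 < e <= 1 & forall delta, 0 < delta -> delta < e ->
    (covering_number A delta <= (delta `^ (- t))%:E)%E.
Proof.
rewrite /upper_box_dim limf_esupE => /ereal_inf_lt[_ [V V0 <-] Vt].
have [e /andP[e0 e1] eV] := near_at_right0 V0.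
exists e => [|x x0 xe]; first by rewrite e0.
rewrite -covering_exponentE ?x0 ?(lt_le_trans xe)//.
apply: le_trans (ltW Vt); apply: ereal_sup_ubound.
by exists x => //; exact: eV.
Qed.

Lemma upper_box_dim_ge0 A : A !=set0 -> (0 <= upper_box_dim A)%E.
Proof.
move=> A0; rewrite /upper_box_dim limf_esupE; apply: le_ereal_inf_tmp => _ [V V0 <-].
have [e /andP[e0 e1] eV] := near_at_right0 V0.
have e2 : 0 < e / 2 by rewrite divr_gt0.
have e2e : e / 2 < e by lra.
apply: le_ereal_sup_tmp; exists (lne (covering_number A (e / 2)) * ((- ln (e / 2))^-1)%:E)%E.
  by exists (e / 2) => //; exact: eV.
rewrite mule_ge0 ?lne_ge0 ?covering_number_ge1// lee_fin invr_ge0 oppr_ge0.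
by rewrite ln_le0//; lra.
Qed.

(** A set of diameter at most [delta] contains at most one of the centres of
    disjoint balls of radius at least [delta]. *)
Lemma size_packing_le_covering_number A delta (D : set nat)
    (c : nat -> 'rV[R]_d) (r : nat -> R) (J : seq nat) : uniq J ->
  (forall i, i \in J -> D i) -> trivIset D (fun i => closed_eball (c i) (r i)) ->
  (forall i, i \in J -> A (c i) /\ 0 < delta <= r i) ->
  ((size J)%:R%:E <= covering_number A delta)%E.
Proof.
move=> uJ JD tD Jc; apply: le_ereal_inf_tmp => _ [n [U [dU AU]] <-].
rewrite lee_fin ler_nat.
have /choice[u uP] : forall i, exists v : option 'I_n,
    i \in J -> exists2 w, v = Some w & U w (c i).
  move=> i; have [iJ|iJ] := boolP (i \in J); last by exists None.
  by have [w Uw] := AU _ (Jc i iJ).1; exists (Some w) => _; exists w.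
have uinj : {in J &, injective u}.
  move=> i j iJ jJ uij; have [[w ui Ui] [v uj Uj]] := (uP i iJ, uP j jJ).
  have wv : w = v by apply: Some_inj; rewrite -ui -uj.
  apply: tD; [exact: JD|exact: JD|].
  have [_ /andP[d0 dri]] := Jc i iJ; have [_ /andP[_ drj]] := Jc j jJ.
  exists (c j); rewrite /closed_eball; split => /=; last first.
    by rewrite edistxx (le_trans (ltW d0)).
  apply: le_trans dri; rewrite -lee_fin (le_trans _ (dU w))//.
  by apply: edist_le_diam => //; rewrite wv.
rewrite -(size_map u) (leq_trans (_ : _ <= size (map Some (enum 'I_n)))%N)//.
  apply: uniq_leq_size; first by rewrite map_inj_in_uniq.
  move=> _ /mapP[i iJ ->]; have [w -> _] := uP i iJ.
  by apply/mapP; exists w => //; rewrite mem_enum.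
by rewrite size_map size_enum_ord.
Qed.

Lemma sum_by_class_le (I : eqType) (J : seq I) (k : I -> nat) (F : I -> R)
    (K : nat -> R) (B : R) :
  (forall n, \sum_(i <- J | k i == n) F i <= K n) ->
  (forall n, \sum_(j < n) K j <= B) -> \sum_(i <- J) F i <= B.
Proof.
move=> FK KB; pose n := \max_(i <- J) (k i).+1.
apply: le_trans (KB n).
apply: (@le_trans _ _ (\sum_(j < n) \sum_(i <- J | k i == j) F i)); last first.
  by apply: ler_sum => j _; exact: FK.
rewrite (exchange_big_dep xpredT)//= big_seq [leRHS]big_seq.
apply: ler_sum => i iJ.
have kn : (k i < n)%N by rewrite /n (big_rem i)//= leq_maxl.
by rewrite (big_pred1 (Ordinal kn)).
Qed.

Lemma dyadic_scale r : 0 < r <= 1 ->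
  exists k, 2^-1 ^+ k.+1 < r <= 2^-1 ^+ k.
Proof.
move=> /andP[r0 r1].
have ex : exists k, 2^-1 ^+ k.+1 < r.
  exists (Num.bound r^-1); rewrite exprVn invf_plt ?posrE ?exprn_gt0//.
  rewrite (lt_trans (archi_boundP _)) ?invr_ge0 ?(ltW r0)//.
  by rewrite -natrX ltr_nat (leq_trans (ltn_expl _ (isT : 1 < 2)%N))// leq_exp2l.
case: (ex_minnP ex) => k kr kmin; exists k; rewrite kr/=.
case: k kr kmin => [|k] kr kmin; first by rewrite expr0.
by rewrite leNgt; apply/negP => /kmin; rewrite ltnn.
Qed.

Lemma sum_geometric_le (x : R) n : 0 <= x < 1 ->
  \sum_(j < n) x ^+ j <= (1 - x)^-1.
Proof.
move=> /andP[x0 x1]; have x1' : 0 < 1 - x by rewrite subr_gt0.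
rewrite -[leRHS]mulr1 ler_pdivlMl//.
have := subrX1 x n; have := exprn_ge0 n x0; lra.
Qed.

Lemma half_powR_lt1 s : 0 < s -> 2^-1 `^ s < 1 :> R.
Proof.
move=> s0; have := @gt0_ltr_powR R s s0 2^-1 1; rewrite powR1; apply.
- by rewrite nnegrE invr_ge0.
- by rewrite nnegrE.
- by rewrite invf_lt1 ?ltr1n.
Qed.

(** Centres of disjoint balls whose radii lie in [(2^-(k+1), 2^-k]] are counted
    by the covering number at scale [2^-(k+1)]; the sum over [k] is geometric
    when the exponent [s] exceeds the growth exponent [t]. *)
Lemma packing_sum_le A t s e (J : seq nat) (D : set nat)
    (c : nat -> 'rV[R]_d) (r : nat -> R) : 0 < s -> t < s -> e <= 1 ->
  (forall delta, 0 < delta -> delta < e ->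
    (covering_number A delta <= (delta `^ (- t))%:E)%E) ->
  uniq J -> (forall i, i \in J -> D i) ->
  trivIset D (fun i => closed_eball (c i) (r i)) ->
  (forall i, i \in J -> A (c i) /\ 0 < r i <= e) ->
  \sum_(i <- J) (2 * r i) `^ s <= 4 `^ s / (1 - 2^-1 `^ (s - t)).
Proof.
move=> s0 ts e1 At uJ JD tD Jc.
have /choice[k kP] : forall i, exists k, i \in J -> 2^-1 ^+ k.+1 < r i <= 2^-1 ^+ k.
  move=> i; have [iJ|iJ] := boolP (i \in J); last by exists 0%N.
  have [_ /andP[r0 re]] := Jc i iJ.
  by have [|k ?] := @dyadic_scale (r i); [rewrite r0 (le_trans re)|exists k].
pose z : R := 2^-1; pose x : R := z `^ (s - t).
have z0 : 0 < z by rewrite invr_gt0.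
have zn n : 0 < z ^+ n by rewrite exprn_gt0.
have x01 : 0 <= x < 1.
  by rewrite powR_ge0/= half_powR_lt1// subr_gt0.
have s4 : 0 < 4 `^ s :> R by rewrite powR_gt0.
apply: (@sum_by_class_le _ J k _ (fun n => 4 `^ s * x ^+ n)) => n; last first.
  by rewrite -mulr_sumr ler_wpM2l ?sum_geometric_le// ltW.
pose Jn := [seq i <- J | k i == n].
rewrite -big_filter -/Jn.
have JnP i : i \in Jn -> i \in J /\ k i = n.
  by rewrite mem_filter => /andP[/eqP ? ?].
have [->|[i0 Jn0]] : Jn = [::] \/ exists i, i \in Jn.
  by case: (Jn) => [|i l]; [left|right; exists i; rewrite mem_head].
  by rewrite big_nil mulr_ge0 ?(ltW s4)// exprn_ge0//; have /andP[] := x01.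
have NJ : (size Jn)%:R <= (z ^+ n.+1) `^ (- t).
  rewrite -lee_fin; apply: le_trans (At _ (zn _) _).
    apply: (@size_packing_le_covering_number _ _ D c r) => //.
    - by rewrite filter_uniq.
    - by move=> i /JnP[/JD].
    - move=> i /JnP[iJ kin]; split; first exact: (Jc i iJ).1.
      by rewrite zn /=; have := kP i iJ; rewrite kin => /andP[/ltW].
  have [iJ kin] := JnP _ Jn0; have := kP _ iJ; rewrite kin => /andP[+ _].
  by move/lt_le_trans; apply; have [_ /andP[]] := Jc _ iJ.
apply: (@le_trans _ _ (\sum_(i <- Jn) (4 * z ^+ n.+1) `^ s)).
  rewrite big_seq [leRHS]big_seq; apply: ler_sum => i /JnP[iJ kin].
  have /andP[_] := kP i iJ; have [_ /andP[r0 _]] := Jc i iJ; rewrite kin => rz.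
  apply: ge0_ler_powR; rewrite ?nnegrE ?mulr_ge0 ?(ltW s0) ?(ltW r0) ?(ltW (zn _))//.
  by rewrite exprS /z; move: rz; lra.
rewrite big_const_seq count_predT iter_addr_0 -[leLHS]mulr_natl.
apply: (@le_trans _ _ ((z ^+ n.+1) `^ (- t) * (4 * z ^+ n.+1) `^ s)).
  by rewrite ler_wpM2r ?powR_ge0.
rewrite powRM ?(ltW (zn _))// mulrCA ler_wpM2l ?(ltW s4)//.
rewrite -powRD; last by rewrite (gt_eqF (zn _)) implybT.
rewrite addrC -powR_mulrn ?(ltW z0)// -powRrM mulrC powRrM powR_mulrn ?powR_ge0//.
rewrite -/x exprS ler_piMl ?exprn_ge0//; by have /andP[x0 /ltW] := x01.
Qed.

(** With [p] strictly between the growth exponent [t] and [s], the sums for the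
    exponent [p] are bounded, and those for [s] carry a further factor
    [(2 * eta) `^ (s - p)] when the radii are at most [eta]. *)
Lemma packing_measure_eq0 A t s e : 0 < s -> t < s -> 0 < e <= 1 ->
  (forall delta, 0 < delta -> delta < e ->
    (covering_number A delta <= (delta `^ (- t))%:E)%E) ->
  packing_measure s A = 0%E.
Proof.
move=> s0 ts /andP[e0 e1] At.
pose p := (Num.max t 0 + s) / 2.
have [p0 pt ps] : [/\ 0 < p, t < p & p < s].
  have := le_max t t 0; have := le_max 0 t 0; rewrite !lexx orbT /= => m0 mt.
  have ms : Num.max t 0 < s by rewrite gt_max ts s0.
  by rewrite /p; split; lra.
pose K := 4 `^ p / (1 - 2^-1 `^ (p - t)).
have bound eta : 0 < eta -> eta <= e ->
    (packing_content s eta A <= ((2 * eta) `^ (s - p) * K)%:E)%E.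
  move=> eta0 etae; apply: ge_ereal_sup => _ [D [c [r [Dc tD ->]]]].
  apply: ge_ereal_sup => _ [F [finF FD] <-].
  rewrite fsbig_finite//= sumEFin lee_fin.
  set J := finmap.enum_fset _.
  have FJ i : i \in J -> D i by rewrite [i \in J]in_fset_set// inE => /FD.
  have Hr i : i \in J -> A (c i) /\ 0 < r i <= e.
    move=> /FJ/Dc[Ac /andP[r0 re]]; rewrite r0 (le_trans re)//.
  apply: (@le_trans _ _ (\sum_(i <- J) (2 * eta) `^ (s - p) * (2 * r i) `^ p)).
    rewrite big_seq [leRHS]big_seq; apply: ler_sum => i iF.
    have [_ /andP[r0 re]] := Dc i (FJ _ iF).
    have nz : 2 * r i != 0 by rewrite gt_eqF// mulr_gt0.
    rewrite -[s in leLHS](subrK p) [leLHS]powRD; last by rewrite nz implybT.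
    rewrite ler_wpM2r ?powR_ge0//.
    by apply: ge0_ler_powR; rewrite ?nnegrE ?subr_ge0 ?mulr_ge0 ?(ltW ps) ?(ltW r0) ?(ltW eta0)// ler_pM2l.
  rewrite -mulr_sumr ler_wpM2l ?powR_ge0//.
  exact: (packing_sum_le p0 pt e1 At (fset_uniq _) FJ tD Hr).
have pre0 : packing_premeasure s A = 0%E.
  apply/eqP; rewrite eq_le; apply/andP; split; last first.
    by apply: le_ereal_inf_tmp => _ [eta _ <-]; exact: packing_content_ge0.
  have K0 : 0 < K.
    by rewrite divr_gt0 ?powR_gt0// subr_gt0 half_powR_lt1// subr_gt0.
  apply/lee_addgt0Pr => eps eps0; rewrite add0e.
  (* the radius at which [(2 * eta) `^ (s - p) * K] is [eps] *)
  pose eta := Num.min e ((eps / K) `^ (s - p)^-1 / 2).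
  have eta0 : 0 < eta by rewrite lt_min e0 divr_gt0// powR_gt0// divr_gt0.
  have etae : eta <= e by rewrite ge_min lexx.
  apply: le_trans (_ : _ <= packing_content s eta A)%E _.
    by apply: ereal_inf_lbound; exists eta.
  apply: le_trans (bound _ eta0 etae) _; rewrite lee_fin -ler_pdivlMr//.
  have -> : eps / K = ((eps / K) `^ (s - p)^-1) `^ (s - p).
    have sp0 : s - p != 0 by rewrite gt_eqF// subr_gt0.
    by rewrite -powRrM mulVf// powRr1// divr_ge0 ?ltW.
  apply: ge0_ler_powR; rewrite ?nnegrE ?subr_ge0 ?mulr_ge0 ?powR_ge0 ?(ltW ps) ?(ltW eta0)//.
  by rewrite mulrC -ler_pdivlMr// ge_min lexx orbT.
apply/eqP; rewrite eq_le; apply/andP; split; last first.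
  apply: le_ereal_inf_tmp => _ [U AU <-]; apply: nneseries_ge0 => n _ _.
  by apply: le_ereal_inf_tmp => _ [eta _ <-]; exact: packing_content_ge0.
apply: ereal_inf_lbound; exists (fun k => if k == 0%N then A else set0).
  by move=> x Ax; exists 0%N.
rewrite eseries0// => k _ _; case: ifP => // _.
apply/eqP; rewrite eq_le; apply/andP; split; last first.
  by apply: le_ereal_inf_tmp => _ [eta _ <-]; exact: packing_content_ge0.
apply: (@ge_ereal_inf _ _ 0%E).
exists (packing_content s 1 (@set0 'rV[R]_d)); first by exists 1 => //=; exact: ltr01.
apply: ge_ereal_sup => _ [D [c [r [Dc _ ->]]]].
rewrite (_ : D = set0) ?esum_set0//.
by rewrite -subset0 => i /Dc[].
Qed.

Lemma packing_dim_le_upper_box_dim A : A !=set0 ->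
  (packing_dim A <= upper_box_dim A)%E.
Proof.
move=> /upper_box_dim_ge0.
have [->|] := eqVneq (upper_box_dim A) +oo%E; first by move=> _; rewrite leey.
rewrite -ltey => uoo u0.
have uf : upper_box_dim A \is a fin_num by rewrite ge0_fin_numE.
move: u0; rewrite -(fineK uf) lee_fin; set u := fine _ => u0.
apply/lee_addgt0Pr => e e0; rewrite -EFinD.
have [|eta eta01 etaP] := @upper_box_dim_lt A (u + e / 2).
  by rewrite -(fineK uf) lte_fin -/u; lra.
have ue0 : 0 < u + e by rewrite ltr_wpDl.
have ue : u + e / 2 < u + e by rewrite ltrD2l; lra.
apply: ereal_inf_lbound; exists (u + e) => //; split => //.
exact: packing_measure_eq0 ue0 ue eta01 etaP.
Qed.

End box_dimension.

(** * The mass distribution principle *)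

Section mass_distribution.
Context {R : realType} {d : nat}.
Variables (m : probability (borelType 'rV[R]_d) R) (F : set 'rV[R]_d) (K s : R).
Hypotheses (mF : measurable (F : set (borelType 'rV[R]_d))) (F1 : m F = 1%E).
Hypotheses (K0 : 0 < K) (s0 : 0 < s).
Hypothesis ball_mass : forall y r, F y -> 0 < r < 1 ->
  exists2 B : set (borelType 'rV[R]_d), measurable B &
    F `&` open_eball y r `<=` B /\ (m B <= (K * r `^ s)%:E)%E.

(** A set of positive diameter lies in the ball of twice its diameter around any
    of its points. The radius is kept above [eta `^ s^-1] because a set of
    diameter [0] lies in no ball of radius [0]. *)
Lemma mass_le_diam (U : set 'rV[R]_d) eta : (diam U <= (4^-1)%:E)%E ->
  0 < eta < 1 ->
  exists2 B : set (borelType 'rV[R]_d), measurable B &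
    F `&` U `<=` B /\ (m B <= (K * 2 `^ s)%:E * diam U `^ s + (K * eta)%:E)%E.
Proof.
move=> U4 /andP[eta0 eta1].
have [[y [Fy Uy]]|FU0] := pselect (F `&` U !=set0); last first.
  exists set0 => //; split; first by move=> y FUy; apply: FU0; exists y.
  by rewrite measure0 adde_ge0 ?mule_ge0 ?poweR_ge0// lee_fin mulr_ge0 ?powR_ge0 ?ltW.
have Uf : diam U \is a fin_num.
  by rewrite ge0_fin_numE ?diam_ge0// (le_lt_trans U4)// ltry.
move: U4 (diam_ge0 U) (fun z => @edist_le_diam _ _ U y z Uy).
rewrite -(fineK Uf) !lee_fin; set D := fine _ => D4 D0 yD.
pose u := eta `^ s^-1; pose r := Num.max (2 * D) u.
have u0 : 0 < u by rewrite powR_gt0.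
have u1 : u < 1.
  have := @gt0_ltr_powR R s^-1; rewrite invr_gt0 => /(_ s0 eta 1).
  by rewrite powR1; apply; rewrite ?nnegrE// ltW.
have us : u `^ s = eta by rewrite /u -powRrM mulVf ?powRr1 ?gt_eqF// ltW.
have r0 : 0 < r by rewrite lt_max u0 orbT.
have r1 : r < 1 by rewrite gt_max u1 andbT; lra.
have [|B mB [FB mBr]] := ball_mass Fy (r := r); first by rewrite r0.
exists B => //; split.
  move=> z [Fz Uz]; apply: FB; split => //; rewrite /open_eball/=.
  have := yD z Uz; rewrite lee_fin /r lt_max => zD.
  have [D0'|D0'] := leP D 0; apply/orP; [right|left].
    by rewrite (le_lt_trans zD)// (le_lt_trans D0').
  by rewrite (le_lt_trans zD)// ltr_pMl// ltr1n.
apply: le_trans mBr _; rewrite poweR_EFin -EFinM -EFinD lee_fin.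
rewrite -mulrA -mulrDr ler_wpM2l ?(ltW K0)// -us -powRM//.
by rewrite /r maxEle; case: ifP => _; rewrite ?lerDl ?lerDr powR_ge0.
Qed.

(** A cover by sets [U i] transports to one by measurable sets whose measures
    are controlled by [diam (U i) `^ s], while [F] has measure [1]; the errors
    [K * eta / 2 ^ i.+1] add up to at most half of that. *)
Lemma hausdorff_measure_gt0 : (0 < hausdorff_measure s F)%E.
Proof.
pose eta := Num.min 2^-1 (2 * K)^-1.
have K2 : 0 < K * 2 `^ s by rewrite mulr_gt0 ?powR_gt0.
have eta01 : 0 < eta < 1.
  by rewrite lt_min !invr_gt0 ltr0n mulr_gt0//= gt_min invf_lt1 ?ltr1n.
have [eta0 eta1] := andP eta01.
pose kappa := 2^-1 / (K * 2 `^ s).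
have kappa0 : 0 < kappa by rewrite divr_gt0.
suff H : (kappa%:E <= hausdorff_content s 4^-1 F)%E.
  apply: (@lt_le_trans _ _ kappa%:E); first by rewrite lte_fin.
  apply: le_trans H _; apply: ereal_sup_ubound; exists 4^-1 => //=.
apply: le_ereal_inf_tmp => _ [U [FU Ud] <-].
pose e_ i := eta / (2 ^ i.+1)%:R.
have e_01 i : 0 < e_ i < 1.
  rewrite /e_ divr_gt0 ?ltr0n ?expn_gt0//= ltr_pdivrMr ?ltr0n ?expn_gt0// mul1r.
  by rewrite (lt_le_trans eta1)// ler1n expn_gt0.
have /choice[B BP] i : exists B : set (borelType 'rV[R]_d), [/\ measurable B,
    F `&` U i `<=` B &
    (m B <= (K * 2 `^ s)%:E * diam (U i) `^ s + (K * e_ i)%:E)%E].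
  by have [B mB [? ?]] := mass_le_diam (Ud i) (e_01 i); exists B.
have FB : F `<=` \bigcup_i B i.
  by move=> y Fy; have [i _ Uy] := FU _ Fy; exists i => //; have [_ + _] := BP i; exact.
have mB i : measurable (B i) by have [] := BP i.
have sub := measure_sigma_subadditive m mB mF FB.
have d0 i : (0 <= (K * 2 `^ s)%:E * diam (U i) `^ s)%E.
  by rewrite mule_ge0 ?poweR_ge0// lee_fin ltW.
have : (1 <= (K * 2 `^ s)%:E * \sum_(i <oo) diam (U i) `^ s + (K * eta)%:E)%E.
  rewrite -F1 (le_trans sub)//.
  rewrite -nneseriesZl => [|i _]; last exact: poweR_ge0.
  apply: (@le_trans _ _ (\sum_(i <oo) ((K * 2 `^ s)%:E * diam (U i) `^ s
      + (K * eta / (2 ^ i.+1)%:R)%:E))%E).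
    apply: lee_nneseries => [i *|i *]; first exact: measure_ge0.
    by have [_ _] := BP i; rewrite /e_ mulrA.
  by apply: epsilon_trick => //; rewrite mulr_ge0 ?ltW.
set S := (\sum_(i <oo) _)%E => S1.
have S0 : (0 <= S)%E by apply: nneseries_ge0 => i _ _; exact: poweR_ge0.
have [->|] := eqVneq S +oo%E; first by rewrite leey.
rewrite -ltey => Soo; have Sf : S \is a fin_num by rewrite ge0_fin_numE.
move: S1; rewrite -(fineK Sf) -EFinM -EFinD !lee_fin => S1.
rewrite /kappa ler_pdivrMr// mulrC.
have : K * eta <= 2^-1.
  rewrite mulrC -ler_pdivlMr// -invfM /eta; apply: le_trans (_ : _ <= (2 * K)^-1) _.
    by rewrite ge_min lexx orbT.
  by [].
by move: S1; lra.
Qed.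

End mass_distribution.

(** * Dimensions of a generalized Moran set *)

Section moran.
Context {R : realType} {d q : nat}.
Variables (tri : set 'rV[R]_d) (f : nat -> 'I_q -> 'rV[R]_d -> 'rV[R]_d).
Variables (c : nat -> 'I_q -> R) (a b : R).
Hypotheses (a0 : 0 < a) (b0 : 0 < b) (b1 : b < 1).
Hypothesis (cab : forall k i, a <= c k.+1 i <= b).

Lemma ratio_gt0 k i : 0 < c k.+1 i.
Proof. by have /andP[/(lt_le_trans a0)] := cab k i. Qed.

Lemma Psi_gt0 k (w : k.-tuple 'I_q) : 0 < Psi c w.
Proof. by apply: prodr_gt0 => j _; exact: ratio_gt0. Qed.

Lemma Psi_le k (w : k.-tuple 'I_q) : Psi c w <= b ^+ k.
Proof.
rewrite -[in leRHS](card_ord k) -prodr_const; apply: ler_prod => j _.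
by have /andP[_ ->] := cab j (tnth w j); rewrite ltW// ratio_gt0.
Qed.

Lemma sum_Psi_powR s k :
  \sum_(w : k.-tuple 'I_q) Psi c w `^ s =
  \prod_(j < k) \sum_(i < q) c j.+1 i `^ s.
Proof.
rewrite bigA_distr_bigA/= (reindex (fun g : {ffun 'I_k -> 'I_q} => [tuple g i | i < k])).
  apply: eq_bigr => g _; rewrite /Psi powR_prod.
    by apply: eq_bigr => j _; rewrite tnth_mktuple.
  by move=> j; rewrite ltW// ratio_gt0.
exists (fun w => [ffun i => tnth w i]) => g _.
  by apply/ffunP => i; rewrite ffunE tnth_mktuple.
by apply: eq_from_tnth => i; rewrite tnth_mktuple ffunE.
Qed.

Lemma sum_Psi_powR_ge0 s k : 0 <= \sum_(w : k.-tuple 'I_q) Psi c w `^ s.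
Proof. by apply: sumr_ge0 => w _; exact: powR_ge0. Qed.

(** Raising the exponent from [s] to [t] multiplies the sum over the words of
    length [k] by at most [b ^ (k (t - s))], which is summable in [k]. *)
Lemma sum_levels_le s t C n : s < t ->
  (forall k, \sum_(w : k.-tuple 'I_q) Psi c w `^ s <= C) ->
  \sum_(k < n) \sum_(w : k.-tuple 'I_q) Psi c w `^ t <= C / (1 - b `^ (t - s)).
Proof.
move=> st ZC; pose x := b `^ (t - s).
have C0 : 0 <= C by rewrite (le_trans (sum_Psi_powR_ge0 s 0)).
have x01 : 0 <= x < 1.
  rewrite powR_ge0/= /x; have := @gt0_ltr_powR R (t - s); rewrite subr_gt0.
  by move=> /(_ st b 1); rewrite powR1; apply; rewrite ?nnegrE// ltW.
apply: (@le_trans _ _ (\sum_(k < n) C * x ^+ k)); last first.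
  by rewrite -mulr_sumr ler_wpM2l ?sum_geometric_le.
apply: ler_sum => k _.
apply: (@le_trans _ _ (\sum_(w : k.-tuple 'I_q) Psi c w `^ s * x ^+ k)); last first.
  by rewrite -mulr_suml ler_wpM2r// exprn_ge0// powR_ge0.
apply: ler_sum => w _; have P0 := Psi_gt0 w.
rewrite -[t in leLHS](subrKC s) powRD; last by rewrite (gt_eqF P0) implybT.
rewrite ler_wpM2l ?powR_ge0// /x -powR_mulrn ?powR_ge0// powRAC powR_mulrn ?(ltW b0)//.
apply: ge0_ler_powR; rewrite ?subr_ge0 ?(ltW st) ?nnegrE ?(ltW P0)//.
- by rewrite exprn_ge0// ltW.
- exact: Psi_le.
Qed.

Lemma Psi_prefix_wordS code n :
  Psi c (prefix_word code n.+1) = Psi c (prefix_word code n) * c n.+1 (code n).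
Proof.
rewrite /Psi big_ord_recr/= tnth_mktuple; congr (_ * _).
by apply: eq_bigr => j _; rewrite !tnth_mktuple.
Qed.

Lemma Psi_prefix_word_le code n :
  a * Psi c (prefix_word code n) <= Psi c (prefix_word code n.+1).
Proof.
rewrite Psi_prefix_wordS mulrC ler_wpM2l ?(ltW (Psi_gt0 _))//.
by have /andP[] := cab n (code n).
Qed.

Lemma Psi_word0 k (w : k.-tuple 'I_q) : k = 0%N -> Psi c w = 1.
Proof. by move=> k0; move: w; rewrite k0 => w; rewrite /Psi big_ord0. Qed.

Lemma expr_lt r : 0 < r -> exists n, b ^+ n < r.
Proof.
move=> r0; have : b ^+ n @[n --> \oo] --> (0 : R).
  by apply: cvg_expr; rewrite gtr0_norm.
move=> /cvgrPdist_lt /(_ r r0)[n _ /(_ n (leqnn n))] H; exists n.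
by move: H; rewrite sub0r normrN gtr0_norm// exprn_gt0.
Qed.

Lemma stopping_prefix code r : 0 < r < 1 ->
  exists n, r < Psi c (prefix_word code n) /\ Psi c (prefix_word code n.+1) <= r.
Proof.
move=> /andP[r0 r1]; have [N Nr] := expr_lt r0.
have ex : exists n, Psi c (prefix_word code n.+1) <= r.
  exists N; rewrite (le_trans (Psi_le _))// ltW// (le_lt_trans _ Nr)//.
  by rewrite exprS ler_piMl ?exprn_ge0 ?ltW.
case: (ex_minnP ex) => n nr nmin; exists n; split => //.
case: n nr nmin => [|n] nr nmin; first by rewrite Psi_word0.
by rewrite ltNge; apply/negP => /nmin; rewrite ltnn.
Qed.

Hypothesis GMS : is_GMS tri f.
Local Notation F := (moran_set tri f).

Lemma cell_closed k (w : k.-tuple 'I_q) : closed (cell tri f w).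
Proof.
apply: compact_closed; first exact: norm_hausdorff.
by have [[_ _ + _ _] _] := GMS; exact.
Qed.

Lemma measurable_cell k (w : k.-tuple 'I_q) :
  measurable (cell tri f w : set (borelType 'rV[R]_d)).
Proof.
have oC : open (~` cell tri f w) by rewrite openC; exact: cell_closed.
rewrite -[X in measurable X]setCK; apply: measurableC.
exact: sub_sigma_algebra.
Qed.

Lemma measurable_moran_set : measurable (F : set (borelType 'rV[R]_d)).
Proof.
apply: bigcapT_measurable => k.
apply: fin_bigcup_measurable => // w _; exact: measurable_cell.
Qed.

Lemma word_rcons k (w : k.+1.-tuple 'I_q) :
  w = [tuple of rcons [tuple tnth w (widen_ord (leqnSn k) j) | j < k] (tnth w ord_max)].
Proof.
apply: eq_from_tnth => i; rewrite [in RHS](tnth_nth (tnth w i))/= nth_rcons size_map size_enum_ord.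
have [ik|ki] := ltnP i k.
  rewrite (nth_map (Ordinal ik)) ?size_enum_ord// (tnth_nth (tnth w i)) [RHS](tnth_nth (tnth w i))/=.
  by rewrite nth_enum_ord.
have {ki}ik : i = k :> nat by apply/eqP; rewrite eqn_leq ki -ltnS ltn_ord.
by rewrite ik eqxx; congr (tnth w _); exact: val_inj.
Qed.

Lemma prefix_word_rcons (code : nat -> 'I_q) k :
  prefix_word code k.+1 = [tuple of rcons (prefix_word code k) (code k)].
Proof.
rewrite [LHS]word_rcons; apply: val_inj => /=; congr rcons; last by rewrite tnth_mktuple.
by apply: eq_map => j; rewrite tnth_mktuple.
Qed.

(** Separation leaves at each level a single word whose cell contains [y];
    nestedness makes these words prefixes of one another, and the vanishing
    diameters single out [y]. *)
Lemma moran_set_coding y : F y -> exists code, is_coding tri f y code.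
Proof.
move=> Fy; have [[_ _ _ nest diam0] disj] := GMS.
have wP k : {w : k.-tuple 'I_q | cell tri f w y}.
  by apply: cid; have [w _ ?] := Fy k I; exists w.
pose w k := projT1 (wP k); have wy k : cell tri f (w k) y := projT2 (wP k).
have uniq k (v : k.-tuple 'I_q) : cell tri f v y -> v = w k.
  move=> vy; apply: contrapT => vw; have := disj k v (w k) vw.
  by rewrite -subset0 => /(_ y); apply; split => //; split.
pose code k := tnth (w k.+1) ord_max.
have codeE k : prefix_word code k = w k.
  elim: k => [|k IH]; first by rewrite [LHS]tuple0 [RHS]tuple0.
  pose v := [tuple tnth (w k.+1) (widen_ord (leqnSn k) j) | j < k].
  have vw : v = w k.
    by apply: uniq; apply: (nest _ _ (tnth (w k.+1) ord_max)); rewrite -word_rcons.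
  by rewrite prefix_word_rcons IH -vw [RHS]word_rcons.
exists code; apply/seteqP; split => [z zc|_ -> k _]; last by rewrite codeE.
apply: esym; apply: edist_eq0; apply/eqP; rewrite eq_le edist_ge0 andbT.
apply/ler_addgt0Pr => e e0; rewrite add0r -lee_fin.
have [k ke] : exists k, (\big[maxe/0%E]_(v : k.-tuple 'I_q) diam (cell tri f v) < e%:E)%E.
  have : \forall k \near \oo, (\big[maxe/0%E]_(v : k.-tuple 'I_q)
      diam (cell tri f v) < e%:E)%E.
    apply: (diam0 [set z : \bar R | (z < e%:E)%E]).
    by apply: open_nbhs_nbhs; split; [exact: open_ereal_lt_ereal|rewrite /= lte_fin].
  by move=> [k _ /(_ k (leqnn k))]; exists k.
have cz : cell tri f (prefix_word code k) z := zc k I.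
have cy : cell tri f (prefix_word code k) y by rewrite codeE; exact: wy.
apply: le_trans (edist_le_diam cy cz) _.
apply: le_trans (ltW ke).
exact: (@le_bigmax _ _ _ 0%E (fun v : k.-tuple 'I_q => diam (cell tri f v)) (prefix_word code k)).
Qed.

Lemma coding_cell y code k : is_coding tri f y code ->
  cell tri f (prefix_word code k) y.
Proof. by move=> yc; have : [set y] y by []; rewrite -yc; apply. Qed.

(** At scale [delta], [F] is covered by the cells [w] with
    [a * rho <= Psi w <= rho], where [rho = delta / C]; each of them contributes
    at least [(a * rho) `^ t] to the sum of [Psi w `^ t] over all words. *)
Lemma covering_number_moran_le t K : UE tri f c -> 0 <= t ->
  (forall n, \sum_(k < n) \sum_(w : k.-tuple 'I_q) Psi c w `^ t <= K) ->
  exists K' e, [/\ 0 < e, 0 < K' & forall delta, 0 < delta -> delta < e ->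
    (covering_number F delta <= (K' * delta `^ (- t))%:E)%E].
Proof.
move=> [C C0 UE_C] t0 ZK; have ac : 0 < a / C by rewrite divr_gt0.
have K1 : 0 < Num.max K 1 by rewrite lt_max ltr01 orbT.
exists (Num.max K 1 * (a / C) `^ (- t)), C; split => //.
  by rewrite mulr_gt0// powR_gt0.
move=> delta d0 dC; pose rho := delta / C.
have rho0 : 0 < rho by rewrite divr_gt0.
have rho1 : rho < 1 by rewrite ltr_pdivrMr// mul1r.
have arho : 0 < a * rho by rewrite mulr_gt0.
have [k1 k1P] := expr_lt arho.
pose S := [set p : {k : 'I_k1 & k.-tuple 'I_q} |
  a * rho <= Psi c (tagged p) <= rho]%SET.
have SP (i : 'I_#|S|) : a * rho <= Psi c (tagged (enum_val i)) <= rho.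
  by have := enum_valP i; rewrite inE.
apply: ge_ereal_inf; exists (#|S|%:R%:E).
  exists #|S| => //; exists (fun i => cell tri f (tagged (enum_val i))); split.
    move=> i; have /andP[_ w_rho] := SP i.
    have k0 : (1 <= tag (enum_val i))%N.
      case: (posnP (tag (enum_val i))) => // kw0; move: w_rho.
      by rewrite Psi_word0// leNgt rho1.
    rewrite (le_trans (UE_C _ _ k0))// lee_fin.
    by rewrite mulrC -ler_pdivlMr.
  move=> y /moran_set_coding[code yc].
  have [|n [nr nr1]] := @stopping_prefix code rho; first by rewrite rho0.
  have ar : a * rho <= Psi c (prefix_word code n.+1).
    by apply: le_trans (Psi_prefix_word_le code n); rewrite ler_wpM2l ?ltW.
  have nk : (n.+1 < k1)%N.
    rewrite ltnNge; apply/negP => kn; move: k1P; apply/negP; rewrite -leNgt.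
    apply: le_trans ar (le_trans (Psi_le _) _).
    by rewrite ler_wiXn2l ?(ltW b0) ?(ltW b1).
  pose p : {k : 'I_k1 & k.-tuple 'I_q} :=
    Tagged (fun k : 'I_k1 => k.-tuple 'I_q) (prefix_word code (Ordinal nk)).
  have pS : p \in S by rewrite inE /= ar nr1.
  by exists (enum_rank_in pS p); rewrite enum_rankK_in//; exact: coding_cell.
rewrite lee_fin -mulrA -powRM ?divr_ge0 ?(ltW a0) ?(ltW C0) ?(ltW d0)//.
have -> : a / C * delta = a * rho by rewrite /rho; ring.
rewrite powRN ler_pdivlMr ?powR_gt0//.
have SK : #|S|%:R * (a * rho) `^ t <= K.
  apply: le_trans (ZK k1); rewrite sig_big_dep /= mulr_natl -sumr_const.
  rewrite [leRHS](bigID (mem S))/= ler_wpDr//.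
    by apply: sumr_ge0 => p _; exact: powR_ge0.
  apply: ler_sum => p; rewrite inE => /andP[aw _].
  by apply: ge0_ler_powR; rewrite // nnegrE ?(ltW arho)// ltW// Psi_gt0.
by rewrite (le_trans SK)// le_max lexx.
Qed.

Lemma upper_box_dim_moran_le s : UE tri f c -> 0 <= s ->
  (forall t, s < t -> exists C, forall k,
    \sum_(w : k.-tuple 'I_q) Psi c w `^ t <= C) ->
  (upper_box_dim F <= s%:E)%E.
Proof.
move=> ue s0 Zs; apply/lee_addgt0Pr => e e0; rewrite -EFinD.
have [C ZC] := Zs (s + e / 3) ltac:(lra).
have lt23 : s + e / 3 < s + 2 * e / 3 by lra.
have [||K' [e' [e'0 K'0 H]]] :=
    @covering_number_moran_le (s + 2 * e / 3) (C / (1 - b `^ (s + 2 * e / 3 - (s + e / 3)))) ue.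
- lra.
- by move=> n; exact: sum_levels_le.
by apply: upper_box_dim_le_growth e'0 K'0 _ H; lra.
Qed.

(** Words entering the covering at scale [r] have [Psi w <= r / a]; the lower
    bound on the sums makes the measure of their cells comparable to
    [r `^ t]. *)
Lemma moran_ball_mass t kappa (m : probability (borelType 'rV[R]_d) R) (L : R) :
  0 < t -> 0 < kappa -> LE tri f c -> 0 < L ->
  (forall k, kappa <= \sum_(w : k.-tuple 'I_q) Psi c w `^ t) ->
  (forall k (w : k.-tuple 'I_q), (1 <= k)%N ->
     fine (m (cell tri f w)) / Psi c w `^ t <=
       L / (\sum_(w' : k.-tuple 'I_q) Psi c w' `^ t)) ->
  exists2 K, 0 < K & forall y r, F y -> 0 < r < 1 ->
  exists2 B : set (borelType 'rV[R]_d), measurable B &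
    F `&` open_eball y r `<=` B /\ (m B <= (K * r `^ t)%:E)%E.
Proof.
move=> t0 kappa0 [M0 le_M0] L0 Zk mL.
(* the maximum with [1] is for the empty word, to which (A3) does not apply *)
pose K1 := Num.max 1 (L / kappa).
have K10 : 0 < K1 by rewrite lt_max ltr01.
have cell_le k (w : k.-tuple 'I_q) : (m (cell tri f w) <= (K1 * Psi c w `^ t)%:E)%E.
  have mw := measurable_cell w.
  have [k0|k0] := posnP k.
    apply: le_trans (probability_le1 _ mw) _; rewrite lee_fin Psi_word0//.
    by rewrite powR1 mulr1 le_max lexx.
  rewrite -[leLHS]fineK ?fin_num_measure// lee_fin -ler_pdivrMr ?powR_gt0 ?Psi_gt0//.
  rewrite (le_trans (mL _ _ k0))// le_max; apply/orP; right.
  by rewrite ler_wpM2l ?(ltW L0)// lef_pV2// posrE (lt_le_trans kappa0).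
exists (M0.+1%:R * (K1 * a^-1 `^ t)).
  by rewrite mulr_gt0// mulr_gt0// powR_gt0// invr_gt0.
move=> y r Fy /andP[r0 r1].
have [|N NM card_N] := le_M0 y r Fy; first by rewrite r0.
have /card_esym/ppcard_eqP[g] := card_N.
have gP j : exists B : set (borelType 'rV[R]_d), [/\ measurable B,
    (m B <= (K1 * (r / a) `^ t)%:E)%E & (j < N)%N -> g j `<=` B].
  have [jN|jN] := ltnP j N; last first.
    by exists set0; split=> //; rewrite measure0 lee_fin mulr_ge0 ?powR_ge0// ltW.
  have /= [[z [code [n [Fz zc _ nr ->]]]] _] := @funS _ _ _ _ g j jN.
  exists (cell tri f (prefix_word code n)); split.
  - exact: measurable_cell.
  - rewrite (le_trans (cell_le _ _))// lee_fin ler_wpM2l ?(ltW K10)//.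
    apply: ge0_ler_powR; rewrite ?nnegrE ?(ltW t0) ?(ltW (Psi_gt0 _)) ?divr_ge0 ?(ltW a0) ?(ltW r0)//.
    by rewrite ler_pdivlMr// mulrC (le_trans (Psi_prefix_word_le _ _)).
  - by move=> _ u [_ [code' uc <-]]; exact: coding_cell.
have /choice[B BP] := gP.
have mB j : measurable (B j) by have [] := BP j.
exists (\big[setU/set0]_(j < N) B j); first exact: bigsetU_measurable.
split.
  move=> u [Fu yu]; have [code uc] := moran_set_coding Fu.
  have [|n [nr nr1]] := @stopping_prefix code r; first by rewrite r0.
  have : (g @` `I_N) (cylinder tri f (prefix_word code n)).
    rewrite image_eq; split; first by exists u, code, n.
    by exists u; split => //; split => //; exists code.
  move=> [j /= jN gj]; rewrite -bigcup_mkord; exists j => //.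
  have [_ _ /(_ jN)] := BP j; apply; rewrite gj; split => //.
  by exists code.
have sumB n : (m (\big[setU/set0]_(j < n) B j) <= (n%:R * (K1 * (r / a) `^ t))%:E)%E.
  elim: n => [|n IH]; first by rewrite big_ord0 measure0 mul0r.
  rewrite big_ord_recr/=.
  have mU : measurable (\big[setU/set0]_(j < n) B j) by exact: bigsetU_measurable.
  apply: (@le_trans _ _ (m (\big[setU/set0]_(j < n) B j) + m (B n))%E).
    exact: measureU2.
  have [_ mBn _] := BP n.
  by rewrite -natr1 mulrDl mul1r EFinD leeD.
rewrite (le_trans (sumB N))// lee_fin powRM ?(ltW r0) ?invr_ge0 ?(ltW a0)//.
rewrite -!mulrA [X in K1 * X]mulrC ler_wpM2r ?mulr_ge0 ?powR_ge0 ?(ltW K10)//.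
by rewrite ler_nat (leq_trans (ltnW NM)).
Qed.

Lemma hausdorff_dim_moran_ge s : LE tri f c -> A3 tri f c ->
  (forall t, 0 < t < s -> exists2 kappa, 0 < kappa & forall k,
    kappa <= \sum_(w : k.-tuple 'I_q) Psi c w `^ t) ->
  (s%:E <= hausdorff_dim F)%E.
Proof.
move=> le_F a3 Zs; apply: le_ereal_inf_tmp => _ [t [t0 Ht] <-].
rewrite lee_fin leNgt; apply/negP => ts.
have [|kappa kappa0 Zk] := Zs t; first by rewrite t0.
have [m [L [mF L0 mL]]] := a3 t t0.
have [||K K0 ball] := moran_ball_mass t0 kappa0 le_F L0 (m := m).
- exact: Zk.
- by move=> k w k0; have /andP[] := mL k w k0.
by have := hausdorff_measure_gt0 measurable_moran_set mF K0 t0 ball; rewrite Ht ltxx.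
Qed.

(** In [s <= dim_H <= dim_P <= dim_B <= s] only the outermost inequalities use
    the Moran structure. *)
Lemma moran_dimensions s : LE tri f c -> A3 tri f c -> UE tri f c -> 0 <= s ->
  (forall t, s < t -> exists C, forall k,
    \sum_(w : k.-tuple 'I_q) Psi c w `^ t <= C) ->
  (forall t, 0 < t < s -> exists2 kappa, 0 < kappa & forall k,
    kappa <= \sum_(w : k.-tuple 'I_q) Psi c w `^ t) ->
  [/\ hausdorff_dim F = s%:E, packing_dim F = s%:E & upper_box_dim F = s%:E].
Proof.
move=> le_F a3 ue s0 Zup Zlow.
have F0 : F !=set0.
  have [m [_ [mF _ _]]] := a3 1 ltr01; apply/set0P/negP => /eqP F_eq0.
  by move: mF; rewrite F_eq0 measure0 => /eqP; rewrite eq_sym onee_eq0.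
have sH := hausdorff_dim_moran_ge le_F a3 Zlow.
have HP := hausdorff_dim_le_packing_dim F.
have PB := packing_dim_le_upper_box_dim F0.
have Bs := upper_box_dim_moran_le ue s0 Zup.
split; apply/eqP; rewrite eq_le; apply/andP; split => //.
- exact: le_trans HP (le_trans PB Bs).
- exact: le_trans PB Bs.
- exact: le_trans sH HP.
- exact: le_trans sH (le_trans HP PB).
Qed.

End moran.

(** * Almost every base point *)

Section continuous_observables.
Context {R : realType} {M : pmetricType R}.

Lemma hoelder_continuous_continuous (g : M -> R) :
  hoelder_continuous g -> continuous g.
Proof.
move=> [alpha [C [al0 _ gC]]] x; apply/cvgrPdist_le => e e0.
pose C' := Num.max C 1; have C'0 : 0 < C' by rewrite lt_max ltr01 orbT.
pose delta := (e / C') `^ alpha^-1.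
have delta0 : 0 < delta by rewrite powR_gt0// divr_gt0.
apply/nbhs_ballP; exists delta => //= y; rewrite ballEmdist/= => xy.
apply: le_trans (gC x y) _.
apply: (@le_trans _ _ (C' * mdist x y `^ alpha)).
  by rewrite ler_wpM2r ?powR_ge0// le_max lexx.
rewrite mulrC -ler_pdivlMr//.
have -> : e / C' = delta `^ alpha.
  by rewrite /delta -powRrM mulVf ?gt_eqF// powRr1// divr_ge0// ltW.
by apply: ge0_ler_powR; rewrite ?nnegrE ?mdist_ge0// ltW.
Qed.

Lemma continuous_measurable_borel (g : M -> R) : continuous g ->
  measurable_fun [set: borelType M] g.
Proof.
move=> cg; apply: (@measurability _ _ (borelType M) _ setT g _ (RGenOInfty.measurableE R)).
move=> _ [_ [x ->] <-]; rewrite setTI; apply: sub_sigma_algebra.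
by apply: open_comp => [y _|]; [exact: cg|exact: rray_open].
Qed.

(** Compactness turns the pointwise bounds into uniform ones, common to the
    finitely many functions. *)
Lemma compact_uniform_bounds (q : nat) (phi : 'I_q -> M -> R) :
  compact [set: M] -> (forall i, continuous (phi i)) ->
  (forall i y, 0 < phi i y < 1) ->
  exists a b, [/\ 0 < a, 0 < b, b < 1 & forall i y, a <= phi i y <= b].
Proof.
move=> cM cphi phi01.
have ne : [set: M] !=set0 by exists point.
have wc i : {within [set: M], continuous (phi i)}.
  exact/continuous_subspaceT/cphi.
have /choice[u uP] i : exists u, forall y, phi i u <= phi i y.
  by have [u _ uP] := compact_EVT_min ne cM (wc i); exists u => y; apply: uP; rewrite inE.
have /choice[v vP] i : exists v, forall y, phi i y <= phi i v.
  by have [v _ vP] := compact_EVT_max ne cM (wc i); exists v => y; apply: vP; rewrite inE.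
exists (\big[Num.min/1]_(i < q) phi i (u i)), (\big[Num.max/2^-1]_(i < q) phi i (v i)).
split.
- by apply: lt_bigmin => [|i _]//; have /andP[] := phi01 i (u i).
- by apply: lt_le_trans (bigmax_ge_id _ _ _ _); rewrite invr_gt0.
- apply: bigmax_lt => [|i _]; first by rewrite invf_lt1 ?ltr1n.
  by have /andP[] := phi01 i (v i).
- move=> i y; apply/andP; split.
    by rewrite (le_trans _ (uP i y))// bigmin_le_cond.
  by rewrite (le_trans (vP i y))// le_bigmax.
Qed.

End continuous_observables.

Theorem theorem5 (R : realType) (d q : nat) (hd : (1 <= d)%N) (hq : (1 <= q)%N)
  (M : pmetricType R) (hM : compact [set: M])
  (lam : {measure set (borelType M) -> \bar R})
  (mu : 'I_q -> probability (borelType M) R)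
  (T : 'I_q -> borelType M -> borelType M)
  (hpres : forall i, measure_preserving (mu i) (T i))
  (hdens : forall i, has_Lp_density lam (mu i))
  (hmix : forall i, mixing (mu i) (T i))
  (phi : 'I_q -> M -> R)
  (hphi : forall i y, 0 < phi i y < 1)
  (hhoelder : forall i, hoelder_continuous (phi i))
  (hlog : forall i, (\int[mu i]_y (ln (phi i y))%:E < 0)%E)
  (tri : q.-tuple (borelType M) -> set 'rV[R]_d)
  (f : q.-tuple (borelType M) -> nat -> 'I_q -> 'rV[R]_d -> 'rV[R]_d)
  (hGMS : forall x, is_GMS (tri x) (f x))
  (hbasic : forall x, basic (orbit_ratio T phi x))
  (hUE : forall x, UE (tri x) (f x) (orbit_ratio T phi x))
  (hLE : forall x, LE (tri x) (f x) (orbit_ratio T phi x))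
  (hA3 : forall x, A3 (tri x) (f x) (orbit_ratio T phi x)) :
  exists s : R,
    unique (fun s' : R =>
      (\int[prod_probability mu]_x
         (ln (\sum_(i < q) phi i (tnth x i) `^ s'))%:E = 0)%E) s /\
    {ae prod_probability mu, forall x,
      [/\ hausdorff_dim (moran_set (tri x) (f x)) = s%:E,
          packing_dim (moran_set (tri x) (f x)) = s%:E &
          upper_box_dim (moran_set (tri x) (f x)) = s%:E]}.
Proof.
have cphi i := hoelder_continuous_continuous (hhoelder i).
have [a [b [a0 b0 b1 ab]]] := compact_uniform_bounds hM cphi hphi.
pose P := prod_probability mu; pose tau := tuple_map T.
pose h i (x : q.-tuple (borelType M)) := phi i (tnth x i).
have mh i : measurable_fun setT (h i).
  exact: (measurableT_comp (continuous_measurable_borel (cphi i)) (measurable_tnth i)).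
have hab i x : a <= h i x <= b by exact: ab.
have [taup taum] := mixing_prod_probability hpres hmix.
have [s [s0 Ps]] := pressure_zero P hq a0 b1 mh hab.
have plt := pressure_lt P hq a0 b1 mh hab.
pose g t := pressure_fun h t.
have mg t : measurable_fun setT (g t) by exact: measurable_pressure_fun.
have gb t x := pressure_fun_bound hq a0 b1 hab t x.
have Pint t : (\int[P]_x (g t x)%:E = (pressure P h t)%:E)%E.
  by exact: pressureE hq a0 b1 mh hab t.
exists s; split.
  split; first by have := Pint s; rewrite Ps.
  move=> t Pt; have Pt0 : pressure P h t = 0.
    by apply/eqP; rewrite -(eqe _ 0) -Pint; apply/eqP; exact: Pt.
  by have [/plt|/plt|//] := ltgtP s t; rewrite Ps Pt0 ltxx.
have up t : s < t -> {ae P, forall x, exists C, forall n,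
    \sum_(j < n) g t (iter j tau x) <= C}.
  move=> /plt st; apply: (birkhoff_bounded_above taup taum (mg t) (gb t)).
  by rewrite Pint lte_fin; rewrite Ps in st.
have low t : t < s -> {ae P, forall x, exists C, forall n,
    \sum_(j < n) - g t (iter j tau x) <= C}.
  move=> /plt st; apply: (birkhoff_bounded_above (g := fun x => - g t x) taup taum).
  - exact: (measurable_funN (mg t)).
  - by move=> x; rewrite normrN; exact: gb.
  under eq_integral do rewrite EFinN.
  rewrite integralN/=; last first.
    exact: (integrable_add_def measurableT (integrable_pressure_fun P hq a0 b1 mh hab t)).
  by rewrite Pint -EFinN lte_fin oppr_lt0 -Ps.
have seqD n : s < s + n.+1%:R^-1 by rewrite ltrDl invr_gt0.
have seqB n : s - n.+1%:R^-1 < s by rewrite gtrBl invr_gt0.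
have upn := ae_foralln (fun n => up _ (seqD n)).
have lown := ae_foralln (fun n => low _ (seqB n)).
apply: filterS2 upn lown => x upx lowx.
pose c := orbit_ratio T phi x.
have cab k i : a <= c k.+1 i <= b by exact: ab.
pose Z t k := \sum_(w : k.-tuple 'I_q) Psi c w `^ t.
have cE j i : c j i = h i (iter j tau x) by rewrite /h tnth_iter_tuple_map.
have S0 t j : 0 < \sum_(i < q) c j i `^ t.
  by under eq_bigr do rewrite cE; exact: sum_powR_gt0 hq a0 hab t _.
have Z0 t k : 0 < Z t k.
  by rewrite /Z (sum_Psi_powR a0 cab); apply: prodr_gt0.
(* [Psi] starts at level [1], the Birkhoff sums at level [0] *)
have lnZ t k : ln (Z t k) = \sum_(j < k.+1) g t (iter j tau x) - g t x.
  rewrite big_ord_recl addrAC subrr add0r /Z (sum_Psi_powR a0 cab) ln_prod//.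
  apply: eq_bigr => j _; rewrite /g /pressure_fun.
  by congr ln; apply: eq_bigr => i _; rewrite cE.
(* every word has [Psi w <= 1] *)
have Zmono t t' k : t <= t' -> Z t' k <= Z t k.
  move=> tt'; apply: ler_sum => w _; apply: ger_powR => //.
  rewrite (Psi_gt0 a0 cab)/= (le_trans (Psi_le a0 cab w))//.
  by rewrite exprn_ile1 ?ltW.
have gap (u : R) : 0 < u -> exists n : nat, n.+1%:R^-1 <= u.
  move=> u0; exists (Num.bound u^-1).
  rewrite -[leRHS]invrK lef_pV2 ?posrE ?invr_gt0//.
  rewrite (le_trans (ltW (archi_boundP _))) ?invr_ge0 ?(ltW u0)//.
  by rewrite ler_nat.
apply: (moran_dimensions a0 b0 b1 cab (hGMS x) (hLE x) (hA3 x) (hUE x) s0).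
- move=> t st.
  have [n nt] : exists n : nat, s + n.+1%:R^-1 <= t.
    by have [|n nt] := gap (t - s); [rewrite subr_gt0|exists n; rewrite -lerBrDl].
  have [C HC] := upx n; exists (expR (C - g (s + n.+1%:R^-1) x)) => k.
  apply: le_trans (Zmono _ _ k nt) _.
  by rewrite -[leLHS]lnK ?posrE// ler_expR lnZ lerD2r.
- move=> t /andP[t0 ts].
  have [n nt] : exists n : nat, t <= s - n.+1%:R^-1.
    by have [|n nt] := gap (s - t); [rewrite subr_gt0|exists n; rewrite lerBrDr -lerBrDl].
  have [C HC] := lowx n.
  exists (expR (- C - g (s - n.+1%:R^-1) x)) => [|k]; first exact: expR_gt0.
  apply: le_trans (Zmono _ _ k nt).
  rewrite -[leRHS]lnK ?posrE// ler_expR lnZ lerD2r.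
  by have := HC k.+1; rewrite sumrN; lra.
Qed.
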